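(* Fix $\alpha\in(0,1)$ with $\alpha\neq 1/n$ for all $n\in\mathbb N$, and let $\mathscr C^\alpha$ denote the space of $\alpha$-branched rough paths (with the metric $\rho_\alpha$). For $\mathbf X\in\mathscr C^\alpha$, denote by $\mathscr D^\alpha_{\mathbf X}$ the associated Banach space of controlled paths (with the norm $|||\cdot|||_\alpha$). Then the family $(\mathscr D^\alpha_{\mathbf X})_{\mathbf X\in\mathscr C^\alpha}$ forms a continuous field of Banach spaces over $\mathscr C^\alpha$.
   Context: Forests. $A$ is a fixed finite nonempty set. $\mathcal F$ is the set of forests (commutative monomials of non-planar rooted trees with nodes labelled by $A$), including the empty forest $\mathbf 1$; $\mathcal H$ is the real vector space with basis $\mathcal F$, i.e. the polynomial algebra on trees. $|h|$ is the number of nodes of $h\in\mathcal F$; $\mathcal F_{(n)}=\{h\in\mathcal F:|h|\le n\}$, $\mathcal F^+_{(n)}=\mathcal F_{(n)}\setminus\{\mathbf 1\}$. For $a\in A$, $[h]_a$ is the tree obtained by grafting the trees of $h$ on a new root labelled $a$. The coproduct $\Delta:\mathcal H\to\mathcal H\otimes\mathcal H$ is the algebra morphism with $\Delta[h]_a=(\mathrm{id}\otimes[\cdot]_a)\Delta h+[h]_a\otimes\mathbf 1$. On $\mathcal H^*$, $\langle\phi\star\psi,h\rangle=\langle\phi\otimes\psi,\Delta h\rangle$. A forest $h$ is identified with the functional $h'\mapsto\delta_{h,h'}$, so $\bar h\star h$ is a finite linear combination of forests. Rough paths. $T>0$ is fixed; $N=\lfloor1/\alpha\rfloor$. An $\alpha$-branched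 rough path is a family $\mathbf X=(\mathbf X_{s,t})_{s,t\in[0,T]}$ of characters (unital multiplicative linear functionals) of $\mathcal H$ with $\mathbf X_{s,u}\star\mathbf X_{u,t}=\mathbf X_{s,t}$ and $\sup_{s\ne t}|\langle\mathbf X_{s,t},h\rangle|/|t-s|^{\alpha|h|}<\infty$ for all $h\in\mathcal F$. Write $\mathbf X^h_{s,t}=\langle\mathbf X_{s,t},h\rangle$ and $\|F\|_\gamma=\sup_{s\neq t}|F_{s,t}|/|t-s|^\gamma$. The metric is $\rho_\alpha(\mathbf X,\tilde{\mathbf X})=\max_{h\in\mathcal F^+_{(N)}}\|\mathbf X^h-\tilde{\mathbf X}^h\|_{|h|\alpha}$. Controlled paths. For a path $\mathbf Z:[0,T]\to\mathrm{span}\,\mathcal F_{(N-1)}$ and $h\in\mathcal F_{(N-1)}$ put $R^h_{s,t}=\langle h,\mathbf Z_t\rangle-\langle\mathbf X_{s,t}\star h,\mathbf Z_s\rangle$, and $|||\mathbf Z|||_\alpha=\sum_{h\in\mathcal F_{(N-1)}}(|\langle h,\mathbf Z_0\rangle|+\|R^h\|_{(N-|h|)\alpha})$. $\mathscr D^\alpha_{\mathbf X}$ is the space of $\mathbf Z$ with $|||\mathbf Z|||_\alpha<\infty$; it is a Banach space with the norm $|||\cdot|||_\alpha$. Continuous field. A continuous field of Banach spaces over a topological space $S$ is a family $(E_t)_{t\in S}$ of Banach spaces together with a set $\hat\Gamma\subseteq\prod_{t\in S}E_t$ such that: (i) $\hat\Gamma$ is a linear subspace; (ii) $\{\gamma(t):\gamma\in\hat\Gamma\}$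 is dense in $E_t$ for each $t$; (iii) $t\mapsto\|\gamma(t)\|$ is continuous for each $\gamma\in\hat\Gamma$; (iv) if $\tilde\gamma\in\prod_tE_t$ is such that for every $t\in S$ and $\varepsilon>0$ there is $\gamma_t\in\hat\Gamma$ with $\|\tilde\gamma(x)-\gamma_t(x)\|\le\varepsilon$ for all $x$ in some neighbourhood of $t$, then $\tilde\gamma\in\hat\Gamma$. *)

(* Defs.v *)
From HB Require Import structures.
From mathcomp Require Import all_boot all_order all_algebra finmap.
From mathcomp Require Import all_classical all_reals interval_inference.
From mathcomp Require Import ereal topology normedtype sequences exp.
From mathcomp Require monalg.
Import -(notations) monalg.
Set Implicit Arguments.
Unset Strict Implicit.
Unset Printing Implicit Defensive.
Import Order.TTheory GRing.Theory Num.Theory numFieldNormedType.Exports.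

Local Open Scope classical_set_scope.
Local Open Scope ring_scope.

(* Non-planar trees are represented by planar trees whose lists of subtrees are
   sorted, recursively, for a fixed total order.  That [tree] is the type of
   non-planar decorated trees is the content of [node_branches],
   [root_label_node], [branches_node] and [tree_node_ind]: a tree is uniquely
   [h]_a for a label a and a forest h, and trees are generated in this way. *)
Inductive ptree (A : Type) : Type := PNode of A & seq (ptree A).

Section PlanarTrees.
Variable A : choiceType.

Lemma ptree_ind_seq (P : ptree A -> Prop) :
  (forall a s, foldr (fun u Q => P u /\ Q) True s -> P (PNode a s)) ->
  forall t, P t.
Proof.
move=> H; fix IH 1; case=> a s; apply: H.
elim: s => [|u s IHs]; first exact: I.
by split; [exact: (IH u) | exact: IHs].
Qed.

Fixpoint ptree_encode (t : ptree A) : GenTree.tree A :=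
  let: PNode a s := t in
  GenTree.Node 0 (GenTree.Leaf a :: map ptree_encode s).

Fixpoint ptree_decode (t : GenTree.tree A) : option (ptree A) :=
  if t is GenTree.Node _ (GenTree.Leaf a :: s) then
    Some (PNode a (pmap ptree_decode s))
  else None.

Lemma ptree_encodeK : pcancel ptree_encode ptree_decode.
Proof.
elim/ptree_ind_seq => a s IH /=; congr (Some (PNode a _)).
by elim: s IH => [|u s IHs] //= [-> /IHs ->].
Qed.

HB.instance Definition _ := Choice.copy (ptree A) (pcan_type ptree_encodeK).

Lemma ptree_indP (P : ptree A -> Prop) :
  (forall a s, {in s, forall u, P u} -> P (PNode a s)) -> forall t, P t.
Proof.
move=> H; elim/ptree_ind_seq => a s IH; apply: H.
elim: s IH => [|v s IHs] //= [Pv /IHs Ps] u; rewrite inE => /predU1P[->|] //.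
exact: Ps.
Qed.

Fixpoint psize (t : ptree A) : nat :=
  let: PNode _ s := t in (sumn (map psize s)).+1.

End PlanarTrees.
HB.instance Definition _ (A : countType) := Countable.copy (ptree A) (pcan_type (@ptree_encodeK A)).

Section Trees.
Variable A : finType.

Definition ptree_le : rel (ptree A) := fun t u => (choice.pickle t <= choice.pickle u)%N.

Lemma ptree_le_total : total ptree_le.
Proof. by move=> t u; exact: leq_total. Qed.
Lemma ptree_le_trans : transitive ptree_le.
Proof. by move=> t u v; exact: leq_trans. Qed.
Lemma ptree_le_anti : antisymmetric ptree_le.
Proof. by move=> t u; rewrite /ptree_le -eqn_leq => /eqP/(pcan_inj choice.pickleK). Qed.

Fixpoint canon (t : ptree A) : ptree A :=
  let: PNode a s := t in PNode a (sort ptree_le (map canon s)).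

Lemma canon_idem t : canon (canon t) = canon t.
Proof.
elim/ptree_indP: t => a s IH /=; congr (PNode a _).
rewrite (@map_id_in _ canon); last first.
  move=> u; rewrite mem_sort => /mapP[v vs ->]; exact: IH.
by rewrite sorted_sort ?sort_sorted //; [exact: ptree_le_trans | exact: ptree_le_total].
Qed.

Definition tree := {t : ptree A | canon t == t}.
HB.instance Definition _ := Countable.on tree.

Definition tree_of (t : ptree A) : tree :=
  exist _ (canon t) (introT eqP (canon_idem t)).

(* Commutative monomials of trees; [mone] is the empty forest and [mmul] the
   product of forests. *)
Definition forest := cmonom tree.
HB.instance Definition _ := ConomialDef.on forest.

Definition forest_of (s : seq (ptree A)) : forest :=
  \big[mmul/mone]_(u <- s) ucm (tree_of u).
Definition forest_seq (h : forest) : seq (ptree A) :=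
  flatten [seq nseq (h t) (val t) | t <- finsupp h].

(* [h]_a *)
Definition node (a : A) (h : forest) : tree := tree_of (PNode a (forest_seq h)).
Definition root_label (t : tree) : A := let: PNode a _ := val t in a.
Definition branches (t : tree) : forest :=
  let: PNode _ s := val t in forest_of s.

Lemma tree_ofK (t : tree) : tree_of (val t) = t.
Proof. by apply: val_inj; exact: (eqP (valP t)). Qed.

Lemma forest_ofE s t : forest_of s t = count_mem t (map tree_of s).
Proof.
elim: s => [|u s IH]; first by rewrite /forest_of big_nil cm1.
by rewrite /forest_of big_cons cmM cmU -/(forest_of s) IH.
Qed.

Lemma forest_seq_count h t : count_mem t (map tree_of (forest_seq h)) = h t.
Proof.
rewrite /forest_seq map_flatten -map_comp count_flatten -map_comp.
rewrite (eq_map (g := fun u => (u == t) * h u)%N); last first.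
  by move=> u /=; rewrite map_nseq tree_ofK count_nseq.
rewrite sumnE big_map.
case: (mdomP h t) => [th|th].
  rewrite (big_fsetD1 t) //= eqxx mul1n big_seq big1 ?addn0 // => u.
  by rewrite in_fsetD1 => /andP[/negPf -> _].
rewrite big_seq big1 // => u uh; case: eqVneq => // ut.
by move: uh th; rewrite ut => ->.
Qed.

Lemma forest_seqK : cancel forest_seq forest_of.
Proof. by move=> h; apply/eqP/cmP => t; rewrite forest_ofE forest_seq_count. Qed.

Lemma forest_of_perm s s' :
  perm_eq (map canon s) (map canon s') -> forest_of s = forest_of s'.
Proof.
move=> e; apply/eqP/cmP => t; rewrite !forest_ofE.
have: perm_eq (map val (map tree_of s)) (map val (map tree_of s')).
  by rewrite -!map_comp.
by move/(perm_map_inj val_inj)/permP.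
Qed.

Lemma forest_of_canon s : forest_of (map canon s) = forest_of s.
Proof. by apply: forest_of_perm; rewrite -map_comp (eq_map canon_idem). Qed.

Lemma canon_forest_seq h : map canon (forest_seq h) = forest_seq h.
Proof.
apply: map_id_in => u /flattenP[/= _ /mapP[t _ ->]].
by rewrite mem_nseq => /andP[_ /eqP ->]; exact: (eqP (valP t)).
Qed.

Lemma root_label_node a h : root_label (node a h) = a.
Proof. by []. Qed.

Lemma branches_node a h : branches (node a h) = h.
Proof.
rewrite /branches /= -[RHS]forest_seqK canon_forest_seq.
by apply: forest_of_perm; rewrite perm_map // perm_sort.
Qed.

Lemma forest_of_count s s' : forest_of s = forest_of s' ->
  perm_eq (map canon s) (map canon s').
Proof.
move=> e; have: perm_eq (map tree_of s) (map tree_of s').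
  by apply/allP => t _ /=; rewrite -!forest_ofE e.
by move/(perm_map val); rewrite -!map_comp.
Qed.

Lemma tree_of_node a s : tree_of (PNode a s) = node a (forest_of s).
Proof.
apply: val_inj => /=; congr (PNode a _).
apply/perm_sortP; [exact: ptree_le_total|exact: ptree_le_trans|exact: ptree_le_anti|].
by apply: forest_of_count; rewrite forest_seqK.
Qed.

Lemma node_branches t : node (root_label t) (branches t) = t.
Proof.
rewrite -{3}(tree_ofK t) /root_label /branches.
by case: (val t) => a s; rewrite tree_of_node.
Qed.

Lemma tree_node_ind (P : tree -> Prop) :
  (forall a (h : forest), {in finsupp h, forall t, P t} -> P (node a h)) -> forall t, P t.
Proof.
move=> H t; rewrite -(tree_ofK t); move: (val t) => {t}.
elim/ptree_indP => a s IH; rewrite tree_of_node; apply: H => t.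
rewrite -cmE_neq0 forest_ofE -lt0n -has_count => /hasP[_ /mapP[u us ->]] /eqP <-.
exact: IH.
Qed.

Definition tsize (t : tree) : nat := psize (val t).
Definition fsize (h : forest) : nat := (\sum_(t <- finsupp h) h t * tsize t)%N.

Lemma psize_canon t : psize (canon t) = psize t.
Proof.
elim/ptree_indP: t => a s IH /=; congr _.+1.
rewrite (perm_sumn (perm_map _ (permEl (perm_sort _ _)))) -map_comp.
by congr sumn; apply/seq.eq_in_map => u /IH.
Qed.

Lemma fsize_seq h : fsize h = sumn (map (@psize _) (forest_seq h)).
Proof.
rewrite /forest_seq map_flatten -map_comp sumn_flatten -map_comp sumnE big_map.
by apply: eq_bigr => t _ /=; rewrite map_nseq sumn_nseq mulnC.
Qed.

Lemma tsize_node a h : tsize (node a h) = (fsize h).+1.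
Proof. by rewrite /tsize /node psize_canon /= fsize_seq. Qed.

End Trees.

(* F x F is the monomial basis of H (x) H, whose product is componentwise. *)
Section ProductMonomial.
Variables M N : conomType.
Implicit Types p q : M * N.

Definition prodm_one : M * N := (mone, mone).
Definition prodm_mul p q : M * N := (mmul p.1 q.1, mmul p.2 q.2).

Lemma prodm_mulA : associative prodm_mul.
Proof. by move=> p q r; rewrite /prodm_mul !mulmA. Qed.
Lemma prodm_mulC : commutative prodm_mul.
Proof. by move=> p q; rewrite /prodm_mul mulmC [mmul p.2 _]mulmC. Qed.
Lemma prodm_mul1m : left_id prodm_one prodm_mul.
Proof. by case=> x y; rewrite /prodm_mul !mul1m. Qed.
Lemma prodm_mulm1 : right_id prodm_one prodm_mul.
Proof. by case=> x y; rewrite /prodm_mul !mulm1. Qed.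
Lemma prodm_unitm p q : prodm_mul p q = prodm_one -> p = prodm_one /\ q = prodm_one.
Proof.
by case: p q => [x y] [x' y'] [] /unitm[/= -> ->] /unitm[/= -> ->].
Qed.

HB.instance Definition _ :=
  Choice_isMonomialDef.Build (M * N)%type prodm_mulA prodm_mul1m prodm_mulm1 prodm_unitm.
HB.instance Definition _ := MonomialDef_isConomialDef.Build (M * N)%type prodm_mulC.
End ProductMonomial.

(* H is the polynomial algebra on trees, i.e. the algebra of the monoid of
   forests; H (x) H is the algebra of the monoid F x F. *)
Notation halg A R := (malg (forest A) R).
Notation halg2 A R := (malg (forest A * forest A)%type R).

(* [fvec] and [coprod] are locked only to keep unification from unfolding
   them. *)
HB.lock Definition fvec (A : finType) (R : realType) (h : forest A) :
    halg A R := mkmalgU h 1.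
Canonical fvec_unlockable := Unlockable fvec.unlock.

Section CoproductForest.
Variables (A : finType) (R : realType).

Definition fvec2 (h k : forest A) : halg2 A R := mkmalgU (h, k) 1.

(* id (x) [.]_a *)
Definition graft_right (a : A) (x : halg2 A R) : halg2 A R :=
  \sum_(p <- msupp x) mcoeff p x *: fvec2 p.1 (ucm (node a p.2)).

(* The recursion Delta [h]_a = (id (x) [.]_a) Delta h + [h]_a (x) 1 along planar
   representatives.  [coprod] satisfies this equation ([coprod_node]) and is an
   algebra morphism ([coprodM], [coprod1] and the linearity instances). *)
Fixpoint pcoprod (t : ptree A) : halg2 A R :=
  let: PNode a s := t in
  graft_right a (foldr (fun u x => pcoprod u * x) 1 s)
  + fvec2 (ucm (tree_of t)) mone.

Definition tcoprod (t : tree A) : halg2 A R := pcoprod (val t).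
Definition fcoprod (h : forest A) : halg2 A R :=
  \prod_(t <- finsupp h) tcoprod t ^+ h t.
End CoproductForest.

HB.lock Definition coprod (A : finType) (R : realType) (x : halg A R) :
    halg2 A R :=
  \sum_(h <- msupp x) mcoeff h x *: fcoprod R h.
Canonical coprod_unlockable := Unlockable coprod.unlock.

Section Hopf.
Variables (A : finType) (R : realType).
Local Notation coprod := (@coprod A R).
Local Notation fcoprod := (@fcoprod A R).
Local Notation tcoprod := (@tcoprod A R).
Local Notation pcoprod := (@pcoprod A R).
Local Notation fvec := (@fvec A R).
Local Notation fvec2 := (@fvec2 A R).
Local Notation graft_right := (@graft_right A R).

Lemma coprodE : coprod = mmap (mkmalgU mone) fcoprod.
Proof.
by rewrite unlock; apply/funext => x; apply: eq_bigr => h _; rewrite mul_malgC.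
Qed.

Lemma fcoprodEw (h : forest A) (d : {fset tree A}) :
  fsubset (finsupp h) d -> fcoprod h = \prod_(t <- d) tcoprod t ^+ h t.
Proof.
move=> le; rewrite [LHS](big_fset_incl _ le) //.
by move=> t td; rewrite -cmE_neq0 negbK => /eqP ->.
Qed.

Lemma fcoprod_mmorphism : mmorphism fcoprod.
Proof.
split=> [h k|]; last by rewrite /fcoprod mdom1 big_seq_fset0.
rewrite (fcoprodEw (fsubset_refl _)) mdomD.
rewrite (fcoprodEw (fsubsetUl _ (finsupp k))) (fcoprodEw (fsubsetUr (finsupp h) _)).
by rewrite -big_split /=; apply: eq_bigr => t _; rewrite cmM exprD.
Qed.

HB.instance Definition _ :=
  isMultiplicative.Build (forest A) (halg2 A R) fcoprod fcoprod_mmorphism.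

Lemma coprod_additive : additive coprod.
Proof. by rewrite coprodE; exact: raddfB. Qed.
HB.instance Definition _ :=
  GRing.isAdditive.Build (halg A R) (halg2 A R) coprod coprod_additive.

Lemma coprod_multiplicative : multiplicative coprod.
Proof. by rewrite coprodE; exact: mmap_is_multiplicative. Qed.
HB.instance Definition _ :=
  GRing.isMultiplicative.Build (halg A R) (halg2 A R) coprod coprod_multiplicative.

Lemma coprod_scalable : scalable coprod.
Proof. by move=> c x; rewrite coprodE mmapZ mul_malgC. Qed.
HB.instance Definition _ :=
  GRing.isScalable.Build R (halg A R) (halg2 A R) *:%R coprod coprod_scalable.

Lemma coprod_fvec h : coprod (fvec h) = fcoprod h.
Proof. by rewrite coprodE unlock mmapU mul_malgC scale1r. Qed.

Lemma foldr_prod (f : ptree A -> halg2 A R) s :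
  foldr (fun u x => f u * x) 1 s = \prod_(u <- s) f u.
Proof.
elim: s => [|u s IH]; first by rewrite big_nil.
by rewrite big_cons -IH.
Qed.

Lemma tree_of_canon (t : ptree A) : tree_of (canon t) = tree_of t.
Proof. by apply: val_inj; exact: canon_idem. Qed.

Lemma pcoprodE a s : pcoprod (PNode a s) =
  graft_right a (\prod_(u <- s) pcoprod u)
  + fvec2 (ucm (tree_of (PNode a s))) mone.
Proof. by rewrite -foldr_prod. Qed.

Lemma pcoprod_canon t : pcoprod (canon t) = pcoprod t.
Proof.
elim/ptree_indP: t => a s IH.
have e : tree_of (canon (PNode a s)) = tree_of (PNode a s).
  exact: tree_of_canon.
rewrite {1}/canon -/canon !pcoprodE e.
apply: (congr1 (fun x => graft_right a x + _)).
rewrite (perm_big _ (permEl (perm_sort _ _))) big_map.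
by rewrite big_seq [RHS]big_seq; apply: eq_bigr => u /IH.
Qed.

Lemma fcoprod_forest_seq h : fcoprod h = \prod_(u <- forest_seq h) pcoprod u.
Proof.
rewrite /forest_seq big_flatten big_map; apply: eq_bigr => t _.
by rewrite big_nseq; elim: (h t) => //= n IH; rewrite -IH exprS.
Qed.

Lemma fcoprod_ucm t : fcoprod (ucm t) = tcoprod t.
Proof. by rewrite /fcoprod mdomU big_seq_fset1 cmUU expr1. Qed.

Lemma coprod_node a h :
  coprod (fvec (ucm (node a h))) =
  graft_right a (coprod (fvec h)) + fvec2 (ucm (node a h)) mone.
Proof.
rewrite [LHS]coprod_fvec fcoprod_ucm /tcoprod pcoprod_canon pcoprodE.
by rewrite -fcoprod_forest_seq -coprod_fvec.
Qed.

Lemma coprodM (x y : halg A R) : coprod (x * y) = coprod x * coprod y.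
Proof. exact: rmorphM. Qed.
Lemma coprod1 : coprod 1 = 1.
Proof. exact: rmorph1. Qed.
Lemma fvec1 : fvec mone = 1. Proof. by rewrite unlock. Qed.
Lemma fvecM h k : fvec (mmul h k) = fvec h * fvec k.
Proof. by rewrite unlock malgM_def fgmulUU mulr1. Qed.

(* <phi (x) psi, x> and <phi * psi, x> = <phi (x) psi, Delta x>. *)
Definition tensor (phi psi : halg A R -> R) (x : halg2 A R) : R :=
  \sum_(p <- msupp x) mcoeff p x * (phi (fvec p.1) * psi (fvec p.2)).
Definition star (phi psi : halg A R -> R) (x : halg A R) : R :=
  tensor phi psi (coprod x).

End Hopf.

Section Truncation.
Variable A : finType.

Definition forests_le (n : nat) : set (forest A) :=
  [set h | (fsize h <= n)%N].
Definition forests_pos (n : nat) : set (forest A) := forests_le n `\ mone.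

Lemma finite_seqs (T : Type) (P : set T) (n : nat) : finite_set P ->
  finite_set [set s : seq T | (size s <= n)%N /\ foldr (fun u Q => P u /\ Q) True s].
Proof.
move=> fP; elim: n => [|n IH].
  by apply: sub_finite_set (finite_set1 [::]) => -[|x s] [].
apply: (@sub_finite_set _ _ ([set [::]] `|`
  [set x :: s | x in P & s in
    [set s : seq T | (size s <= n)%N /\ foldr (fun u Q => P u /\ Q) True s]])).
  move=> [|x s] /=; first by left.
  by rewrite ltnS => -[ss [Px Ps]]; right; exists x => //; exists s.
by rewrite finite_setU; split; [exact: finite_set1 | exact: finite_image2].
Qed.

Lemma size_sumn_psize (s : seq (ptree A)) :
  (size s <= sumn (map (@psize A) s))%N.
Proof.
elim: s => //= -[a u] s IH /=; rewrite addSn ltnS.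
exact: leq_trans IH (leq_addl _ _).
Qed.

Lemma sumn_psize_all (s : seq (ptree A)) n : (sumn (map (@psize A) s) <= n)%N ->
  foldr (fun u Q => (psize u <= n)%N /\ Q) True s.
Proof.
elim: s n => //= u s IH n le; split; first exact: leq_trans (leq_addr _ _) le.
by apply: IH; exact: leq_trans (leq_addl _ _) le.
Qed.

Lemma finite_ptrees n : finite_set [set t : ptree A | (psize t <= n)%N].
Proof.
elim: n => [|n IH].
  by apply: sub_finite_set (finite_set0 _) => -[a s].
apply: sub_finite_set (finite_image2 (@PNode A) (@finite_finset A setT)
  (finite_seqs n IH)) => -[a s] /=.
rewrite ltnS => le; exists a => //; exists s => //=; split.
  exact: leq_trans (size_sumn_psize s) le.
exact: sumn_psize_all le.
Qed.

Lemma finite_forests_le n : finite_set (forests_le n).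
Proof.
apply: sub_finite_set (finite_image (@forest_of A)
  (finite_seqs n (finite_ptrees n))) => h /=.
rewrite /forests_le /= fsize_seq => le; exists (forest_seq h).
  split; [exact: leq_trans (size_sumn_psize _) le | exact: sumn_psize_all le].
exact: forest_seqK.
Qed.

Lemma finite_forests_pos n : finite_set (forests_pos n).
Proof. exact/finite_setD/finite_forests_le. Qed.

End Truncation.

Section TensorLinear.
Variables (A : finType) (R : realType).
Implicit Types (phi psi : halg A R -> R) (x y : halg A R).

Lemma tensorE phi psi :
  tensor phi psi = mmap idfun (fun p => phi (fvec R p.1) * psi (fvec R p.2)).
Proof. by []. Qed.

Lemma tensor_linear phi psi : scalar (tensor phi psi).
Proof.
rewrite tensorE => c x y; rewrite mmapD; congr (_ + _).
rewrite (mmapEw (msuppZ_le c x)) mmapE mulr_sumr; apply: eq_bigr => p _ /=.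
by rewrite mcoeffZ -mulrA.
Qed.

Lemma star_linear phi psi : scalar (star phi psi).
Proof. by move=> c x y; rewrite /star linearP tensor_linear. Qed.
HB.instance Definition _ phi psi :=
  GRing.isLinear.Build R (halg A R) R *%R (star phi psi) (star_linear phi psi).

Lemma starZ phi psi c x : star phi psi (c *: x) = c * star phi psi x.
Proof. exact: linearZ. Qed.

Lemma mkmalgU_fvec c h : mkmalgU h c = c *: fvec R h :> halg A R.
Proof. by rewrite -mul_malgC unlock malgM_def fgmulUU mul1m mulr1. Qed.

Lemma star_sum phi psi x (d : {fset forest A}) : fsubset (msupp x) d ->
  star phi psi x = \sum_(h <- d) mcoeff h x * star phi psi (fvec R h).
Proof.
move=> le; rewrite {1}(monalgEw le) linear_sum; apply: eq_bigr => h _ /=.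
by rewrite mkmalgU_fvec starZ.
Qed.

End TensorLinear.

Section Time.
Variables (R : realType) (T : {posnum R}).

Definition time := {t : R | 0 <= t <= T%:num}.
HB.instance Definition _ := Choice.on time.

Definition time0 : time :=
  exist _ 0 (introT andP (conj (lexx 0) (ge0 T))).

(* Valued in the extended reals, +oo when the supremum is infinite. *)
Definition hoelder (gamma : R) (F : time -> time -> R) : \bar R :=
  ereal_sup [set (`|F p.1 p.2| / `|val p.2 - val p.1| `^ gamma)%:E
            | p in [set p : time * time | p.1 != p.2]].

End Time.

Section HoelderTheory.
Variables (R : realType) (T : {posnum R}).
Implicit Types (F G : time T -> time T -> R) (gamma M : R).

Lemma hoelder_leP gamma F M :
  (hoelder gamma F <= M%:E)%E <->
  (forall s t, s != t -> `|F s t| <= M * `|val t - val s| `^ gamma).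
Proof.
have pos (s t : time T) : s != t -> 0 < `|val t - val s| `^ gamma.
  move=> st; apply: powR_gt0; rewrite normr_gt0 subr_eq0 eq_sym.
  by rewrite (inj_eq val_inj).
split=> [le s t st|H].
  rewrite -ler_pdivrMr ?pos // -lee_fin; apply: le_trans le.
  by apply: ereal_sup_ubound; exists (s, t).
apply: ge_ereal_sup => _ [[s t] /= st <-].
by rewrite lee_fin ler_pdivrMr ?pos //; exact: H.
Qed.

Lemma hoelder_ge0 gamma F : (0 <= hoelder gamma F)%E.
Proof.
have hT : 0 <= T%:num <= T%:num by rewrite ge0 lexx.
pose tT : time T := exist _ T%:num hT.
apply: (@le_trans _ _ (`|F (time0 T) tT| / `|T%:num - 0| `^ gamma)%:E).
  by rewrite lee_fin divr_ge0 // powR_ge0.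
apply: ereal_sup_ubound; exists (time0 T, tT) => //=.
by rewrite -(inj_eq val_inj) /= lt_eqF // gt0.
Qed.

Lemma hoelder_fin gamma F : (hoelder gamma F < +oo)%E ->
  (fine (hoelder gamma F))%:E = hoelder gamma F.
Proof. by move=> h; rewrite fineK // ge0_fin_numE // hoelder_ge0. Qed.

Lemma hoelder_le_fine gamma F s t : (hoelder gamma F < +oo)%E -> s != t ->
  `|F s t| <= fine (hoelder gamma F) * `|val t - val s| `^ gamma.
Proof.
move=> h; move: s t; apply/hoelder_leP.
by rewrite hoelder_fin.
Qed.

Lemma hoelder_le_lty gamma F M : (hoelder gamma F <= M%:E)%E ->
  (hoelder gamma F < +oo)%E.
Proof. by move/le_lt_trans; apply; rewrite ltry. Qed.

Lemma hoelderD_le gamma F G H : (forall s t, H s t = F s t + G s t) ->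
  (hoelder gamma H <= hoelder gamma F + hoelder gamma G)%E.
Proof.
move=> HE; have [->|n1] := eqVneq (hoelder gamma F) +oo%E.
  rewrite addye ?leey // gt_eqF //.
  by apply: lt_le_trans (hoelder_ge0 _ _); rewrite ltNy0.
have [->|n2] := eqVneq (hoelder gamma G) +oo%E.
  rewrite addey ?leey // gt_eqF //.
  by apply: lt_le_trans (hoelder_ge0 _ _); rewrite ltNy0.
rewrite -ltey in n1; rewrite -ltey in n2.
rewrite -(hoelder_fin n1) -(hoelder_fin n2) -EFinD.
apply/hoelder_leP => s t st; rewrite HE mulrDl.
by apply: le_trans (ler_normD _ _) _; apply: lerD; exact: hoelder_le_fine.
Qed.

Lemma hoelderZ_le gamma G H c : (forall s t, H s t = c * G s t) ->
  (hoelder gamma H <= `|c|%:E * hoelder gamma G)%E.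
Proof.
move=> HE; have [c0|c0] := eqVneq c 0.
  rewrite c0 normr0 mul0e; apply/hoelder_leP => s t _.
  by rewrite HE c0 mul0r normr0 mul0r.
have [->|n1] := eqVneq (hoelder gamma G) +oo%E.
  by rewrite gt0_muley ?leey // lte_fin normr_gt0.
rewrite -ltey in n1; rewrite -(hoelder_fin n1) -EFinM.
apply/hoelder_leP => s t st; rewrite HE normrM -mulrA ler_wpM2l //.
exact: hoelder_le_fine.
Qed.

End HoelderTheory.

Section RoughPaths.
Variables (A : finType) (R : realType) (T : {posnum R}) (alpha : R).

Record rough_path : Type := RoughPath {
  rp_fun :> time T -> time T -> {lrmorphism halg A R -> R | *%R};
  rp_chen : forall s u t x, star (rp_fun s u) (rp_fun u t) x = rp_fun s t x;
  rp_hoelder : forall h,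
    (hoelder (alpha * (fsize h)%:R) (fun s t => rp_fun s t (fvec R h)) < +oo)%E
}.

HB.instance Definition _ := gen_eqMixin rough_path.
HB.instance Definition _ := gen_choiceMixin rough_path.

(* N, the integer part of 1 / alpha. *)
Definition rp_level : nat := Num.truncn alpha^-1.

(* All the seminorms involved are finite ([rp_distP]), so that [fine] is
   harmless.  The topology of [rough_path] is that of this distance. *)
Definition rp_dist (X Y : rough_path) : R :=
  fine (\big[maxe/0%E]_(h <- fset_set (@forests_pos A rp_level))
    hoelder (alpha * (fsize h)%:R)
      (fun s t => X s t (fvec R h) - Y s t (fvec R h))).

Lemma rp_distP X Y (M : R) : 0 <= M ->
  rp_dist X Y <= M <->
  (forall h, @forests_pos A rp_level h -> forall s t, s != t ->
    `|X s t (fvec R h) - Y s t (fvec R h)|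
      <= M * `|val t - val s| `^ (alpha * (fsize h)%:R)).
Proof.
move=> M0; set g := fun h => hoelder (alpha * (fsize h)%:R)
      (fun s t => X s t (fvec R h) - Y s t (fvec R h)).
have g_lty h : (g h < +oo)%E.
  have fX := rp_hoelder X h; have fY := rp_hoelder Y h.
  apply: (@hoelder_le_lty _ _ _ _
    (fine (hoelder (alpha * (fsize h)%:R) (fun s t => X s t (fvec R h)))
     + fine (hoelder (alpha * (fsize h)%:R) (fun s t => Y s t (fvec R h))))).
  apply/hoelder_leP => s t st; rewrite mulrDl.
  by apply: le_trans (ler_normB _ _) _; apply: lerD; exact: hoelder_le_fine.
have fin s : (0 <= \big[maxe/0%E]_(h <- s) g h < +oo)%E.
  elim: s => [|h s /andP[IH0 IH]]; rewrite ?big_nil ?big_cons ?lexx ?ltry //.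
  by rewrite le_max hoelder_ge0 /= gt_max g_lty.
rewrite /rp_dist -/g -lee_fin fineK; last first.
  by have /andP[? ?] := fin (fset_set (@forests_pos A rp_level)); rewrite ge0_fin_numE.
have key (s : seq (forest A)) : (\big[maxe/0%E]_(h <- s) g h <= M%:E)%E <->
   (forall h, h \in s -> (g h <= M%:E)%E).
  elim: s => [|h s IH].
    by rewrite big_nil lee_fin; split=> // _ h; rewrite in_nil.
  rewrite big_cons ge_max; split.
    by move=> /andP[hM /IH sM] k; rewrite inE => /predU1P[->|/sM].
  move=> H; rewrite H ?mem_head //=; apply/IH => k ks.
  by apply: H; rewrite inE ks orbT.
split=> [/key H h hF|H].
  by apply/hoelder_leP; apply: H; rewrite in_fset_set ?inE //; exact: finite_forests_pos.
apply/key => h hF; apply/hoelder_leP; apply: H; move: hF.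
by rewrite in_fset_set ?inE //; exact: finite_forests_pos.
Qed.

Lemma rp_dist_ge0 X Y : 0 <= rp_dist X Y.
Proof.
apply: fine_ge0; elim: (fset_set _ : seq _) => [|h s IH].
  by rewrite big_nil.
by rewrite big_cons le_max IH orbT.
Qed.

Lemma rp_distxx X : rp_dist X X = 0.
Proof.
apply/eqP; rewrite eq_le rp_dist_ge0 andbT; apply/rp_distP => // h _ s t _.
by rewrite subrr normr0 mul0r.
Qed.

Lemma rp_dist_sym X Y : rp_dist X Y = rp_dist Y X.
Proof.
wlog suff H : X Y / rp_dist X Y <= rp_dist Y X.
  by apply/eqP; rewrite eq_le !H.
apply/rp_distP => [|h hF s t st]; first exact: rp_dist_ge0.
by rewrite distrC; move: h hF s t st; apply/rp_distP => //; exact: rp_dist_ge0.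
Qed.

Lemma rp_dist_triangle Y X Z : rp_dist X Z <= rp_dist X Y + rp_dist Y Z.
Proof.
apply/rp_distP => [|h hF s t st]; first by rewrite addr_ge0 ?rp_dist_ge0.
rewrite mulrDl; apply: le_trans (ler_distD (Y s t (fvec R h)) _ _) _.
apply: lerD.
  have /rp_distP := lexx (rp_dist X Y); apply => //; exact: rp_dist_ge0.
have /rp_distP := lexx (rp_dist Y Z); apply => //; exact: rp_dist_ge0.
Qed.

Definition rp_ball (X : rough_path) (e : R) : set rough_path :=
  [set Y | rp_dist X Y < e].

Lemma rp_ball_center X (e : R) : 0 < e -> rp_ball X e X.
Proof. by rewrite /rp_ball /= rp_distxx. Qed.

Lemma rp_ball_sym X Y (e : R) : rp_ball X e Y -> rp_ball Y e X.
Proof. by rewrite /rp_ball /= rp_dist_sym. Qed.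

Lemma rp_ball_triangle X Y Z (e1 e2 : R) :
  rp_ball X e1 Y -> rp_ball Y e2 Z -> rp_ball X (e1 + e2) Z.
Proof.
rewrite /rp_ball /= => XY YZ.
by apply: le_lt_trans (rp_dist_triangle Y X Z) _; exact: ltrD.
Qed.

HB.instance Definition _ := hasNbhs.Build rough_path
  (nbhs_ (entourage_ rp_ball)).
HB.instance Definition _ := @Nbhs_isPseudoMetric.Build R rough_path
  (entourage_ rp_ball) erefl rp_ball rp_ball_center rp_ball_sym
  rp_ball_triangle erefl.

End RoughPaths.

Section ControlledPaths.
Variables (A : finType) (R : realType) (T : {posnum R}) (alpha : R).
Variable X : rough_path A T alpha.
Implicit Types (Z : time T -> halg A R) (h : forest A).
Local Notation N := (rp_level alpha).
Local Notation F := (@forests_le A N.-1).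

(* A forest h acts on H as the coefficient functional [mcoeff h]. *)
Definition remainder Z h (s t : time T) : R :=
  mcoeff h (Z t) - star (X s t) (mcoeff h) (Z s).

Definition ctrl_term Z h : \bar R :=
  (`|mcoeff h (Z (time0 T))|%:E
   + hoelder ((N - fsize h)%:R * alpha) (remainder Z h))%E.

Definition ctrl_norm Z : \bar R :=
  (\sum_(h <- fset_set F) ctrl_term Z h)%E.

Definition controlled : {pred time T -> halg A R} :=
  [pred Z | `[< (forall t h, h \in msupp (Z t) -> F h)
              /\ (ctrl_norm Z < +oo)%E >]].

Lemma controlledP Z : reflect
  ((forall t h, h \in msupp (Z t) -> F h) /\ (ctrl_norm Z < +oo)%E)
  (Z \in controlled).
Proof. exact: asboolP. Qed.

Lemma remainderP Z1 Z2 c h s t :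
  remainder (c *: Z1 + Z2) h s t = c * remainder Z1 h s t + remainder Z2 h s t.
Proof.
have e u : (c *: Z1 + Z2) u = c *: Z1 u + Z2 u by [].
have g (k a b x y : R) : k * a + b - (k * x + y) = k * (a - x) + (b - y).
  by rewrite mulrBr opprD addrACA.
by rewrite /remainder !e star_linear mcoeffD mcoeffZ g.
Qed.

Lemma ctrl_term_ge0 Z h : (0 <= ctrl_term Z h)%E.
Proof. by rewrite adde_ge0 ?lee_fin ?hoelder_ge0. Qed.

Lemma ctrl_norm_ge0 Z : (0 <= ctrl_norm Z)%E.
Proof. by apply: sume_ge0 => h _; exact: ctrl_term_ge0. Qed.

Lemma ctrl_term_le Z h (a b : R) :
  `|mcoeff h (Z (time0 T))| <= a ->
  (forall s t, s != t ->
    `|remainder Z h s t| <= b * `|val t - val s| `^ ((N - fsize h)%:R * alpha)) ->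
  (ctrl_term Z h <= (a + b)%:E)%E.
Proof.
move=> ha hb; rewrite /ctrl_term EFinD leeD ?lee_fin //.
exact/hoelder_leP.
Qed.

Lemma ctrl_normD Z1 Z2 : (ctrl_norm (Z1 + Z2)%R <= ctrl_norm Z1 + ctrl_norm Z2)%E.
Proof.
rewrite /ctrl_norm -big_split /=; apply: lee_sum => h _.
rewrite /ctrl_term addeACA; apply: leeD.
  by rewrite -EFinD lee_fin mcoeffD ler_normD.
apply: hoelderD_le => s t.
by have := remainderP Z1 Z2 1 h s t; rewrite scale1r mul1r.
Qed.

Lemma remainderZ c Z h s t : remainder (c *: Z) h s t = c * remainder Z h s t.
Proof.
have e u : (c *: Z) u = c *: Z u by [].
have g (a b : R) : c * a - c * b = c * (a - b) by rewrite mulrBr.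
by rewrite /remainder !e mcoeffZ starZ g.
Qed.

Lemma ctrl_normZ_le c Z : (ctrl_norm (c *: Z)%R <= `|c|%:E * ctrl_norm Z)%E.
Proof.
rewrite /ctrl_norm ge0_sume_distrr; last by move=> h _; exact: ctrl_term_ge0.
apply: lee_sum => h _; rewrite /ctrl_term ge0_muleDr ?lee_fin ?hoelder_ge0 //.
apply: leeD; first by rewrite -EFinM lee_fin mcoeffZ normrM.
by apply: hoelderZ_le => s t; exact: remainderZ.
Qed.

Lemma controlled_submod : submod_closed controlled.
Proof.
split=> [|c Z1 Z2 /controlledP[s1 n1] /controlledP[s2 n2]].
  apply/controlledP; split=> [t h|]; first by rewrite msupp0 inE.
  by have := ctrl_normZ_le 0 0; rewrite scale0r normr0 mul0e => /le_lt_trans; exact.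
apply/controlledP; split=> [t h|].
  move=> /(fsubsetP (msuppD_le _ _)); rewrite in_fsetU => /orP[|/s2//].
  by move=> /(fsubsetP (msuppZ_le _ _)) /s1.
have H := ctrl_normD (c *: Z1) Z2.
apply: (le_lt_trans H); apply: lte_add_pinfty; last exact: n2.
apply: (le_lt_trans (ctrl_normZ_le c Z1)).
apply: lte_mul_pinfty; [by rewrite lee_fin | by [] | exact: n1].
Qed.

HB.instance Definition _ := GRing.isSubmodClosed.Build R
  (time T -> halg A R) controlled controlled_submod.

Record ctrl_path : Type := CtrlPath {
  ctrl_fun :> time T -> halg A R;
  _ : ctrl_fun \in controlled
}.

HB.instance Definition _ := [isSub for ctrl_fun].
HB.instance Definition _ := [Choice of ctrl_path by <:].
HB.instance Definition _ := [SubChoice_isSubLmodule of ctrl_path by <:].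

Implicit Types z : ctrl_path.

Definition ctrl_nrm z : R := fine (ctrl_norm z).

Lemma ctrl_nrmE z : (ctrl_nrm z)%:E = ctrl_norm z.
Proof.
have /controlledP[_ fin] := valP z.
by rewrite /ctrl_nrm fineK // ge0_fin_numE // ctrl_norm_ge0.
Qed.

Lemma ctrl_nrm_ge0 z : 0 <= ctrl_nrm z.
Proof. by rewrite -lee_fin ctrl_nrmE ctrl_norm_ge0. Qed.

Lemma ctrl_supp z t : fsubset (msupp (z t)) (fset_set F).
Proof.
have /controlledP[supp _] := valP z; apply/fsubsetP => h /supp hF.
by rewrite in_fset_set ?inE //; exact: finite_forests_le.
Qed.

Lemma ctrl_term_nrm z h : F h -> (ctrl_term z h <= (ctrl_nrm z)%:E)%E.
Proof.
move=> hF; rewrite ctrl_nrmE /ctrl_norm (big_fsetD1 h) /=.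
  by apply: leeDl; apply: sume_ge0 => k _; exact: ctrl_term_ge0.
by rewrite in_fset_set ?inE //; exact: finite_forests_le.
Qed.

Lemma ctrl_bound0 z h : F h -> `|mcoeff h (z (time0 T))| <= ctrl_nrm z.
Proof.
move=> hF; rewrite -lee_fin; apply: le_trans (ctrl_term_nrm z hF).
by apply: leeDl; exact: hoelder_ge0.
Qed.

Lemma ctrl_boundR z h : F h -> forall s t, s != t ->
  `|remainder z h s t|
    <= ctrl_nrm z * `|val t - val s| `^ ((N - fsize h)%:R * alpha).
Proof.
move=> hF; apply/hoelder_leP; apply: le_trans (ctrl_term_nrm z hF).
by apply: leeDr; rewrite lee_fin.
Qed.

Lemma ctrl_norm_le Z (e : R) : 0 <= e ->
  (forall h, F h -> `|mcoeff h (Z (time0 T))| <= e) ->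
  (forall h, F h -> forall s t, s != t -> `|remainder Z h s t|
    <= e * `|val t - val s| `^ ((N - fsize h)%:R * alpha)) ->
  (ctrl_norm Z <= ((e + e) *+ size (fset_set F))%:E)%E.
Proof.
move=> e0 H0 HR.
have -> : (e + e) *+ size (fset_set F) = \sum_(h <- fset_set F) (e + e).
  by rewrite big_const_seq count_predT iter_addr addr0.
rewrite -sumEFin /ctrl_norm big_seq [leRHS]big_seq; apply: lee_sum => h.
rewrite in_fset_set; last exact: finite_forests_le.
by rewrite inE => hF; apply: ctrl_term_le; [exact: H0 | exact: HR].
Qed.

Lemma ctrl_bound t h :
  exists2 C : R, 0 <= C & forall z, `|mcoeff h (z t)| <= C * ctrl_nrm z.
Proof.
have [hF|hF] := pselect (F h); last first.
  exists 0 => // z; have /controlledP[supp _] := valP z.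
  rewrite mcoeff_outdom ?normr0 ?mul0r //.
  by apply/negP => /supp.
have [->|t0] := eqVneq t (time0 T).
  by exists 1 => // z; rewrite mul1r; exact: ctrl_bound0.
pose c k := `|star (X (time0 T) t) (mcoeff h) (fvec R k)|.
exists (`|val t - val (time0 T)| `^ ((N - fsize h)%:R * alpha)
        + \sum_(k <- fset_set F) c k).
  by rewrite addr_ge0 ?powR_ge0 ?sumr_ge0 // => k _; rewrite normr_ge0.
move=> z.
have -> : mcoeff h (z t) = remainder z h (time0 T) t
    + star (X (time0 T) t) (mcoeff h) (z (time0 T)).
  by rewrite /remainder subrK.
rewrite mulrDl; apply: le_trans (ler_normD _ _) _; apply: lerD.
  by rewrite mulrC; apply: ctrl_boundR => //; rewrite eq_sym.
rewrite (star_sum _ _ (ctrl_supp z (time0 T))) mulr_suml.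
apply: le_trans (ler_norm_sum _ _ _) _.
rewrite big_seq [leRHS]big_seq; apply: ler_sum => k.
rewrite in_fset_set; last exact: finite_forests_le.
rewrite inE => kF; rewrite normrM mulrC; apply: ler_wpM2l => //.
exact: ctrl_bound0.
Qed.

Lemma ctrl_nrmD z1 z2 : ctrl_nrm (z1 + z2) <= ctrl_nrm z1 + ctrl_nrm z2.
Proof.
by rewrite -lee_fin EFinD !ctrl_nrmE; exact: ctrl_normD.
Qed.

Lemma ctrl_nrmZ_le (c : R) z : ctrl_nrm (c *: z) <= `|c| * ctrl_nrm z.
Proof. by rewrite -lee_fin EFinM !ctrl_nrmE; exact: ctrl_normZ_le. Qed.

Lemma ctrl_nrmZ (c : R) z : ctrl_nrm (c *: z) = `|c| * ctrl_nrm z.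
Proof.
have [->|c0] := eqVneq c 0.
  apply/eqP; rewrite eq_le ctrl_nrmZ_le normr0 mul0r ctrl_nrm_ge0 //.
apply/eqP; rewrite eq_le ctrl_nrmZ_le /= mulrC -ler_pdivlMr ?normr_gt0 //.
have := ctrl_nrmZ_le c^-1 (c *: z).
by rewrite scalerA mulVf // scale1r normfV mulrC.
Qed.

Lemma ctrl_nrm0_eq0 z : ctrl_nrm z = 0 -> z = 0.
Proof.
move=> z0; apply: val_inj; apply/funext => t; apply/malgP => h.
have [C _ /(_ z)] := ctrl_bound t h.
by rewrite z0 mulr0 normr_le0 => /eqP ->; rewrite mcoeff0.
Qed.

HB.instance Definition _ := Lmodule_isNormed.Build R ctrl_path
  ctrl_nrmD ctrl_nrmZ ctrl_nrm0_eq0.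

Lemma ctrl_normE z : `|z| = ctrl_nrm z. Proof. by []. Qed.

Lemma cvg_rsum (I : eqType) (V : Type) (G : set_system V) {GG : Filter G}
    (r : seq I) (f : I -> V -> R) (l : I -> R) :
  (forall i, i \in r -> f i @ G --> l i) ->
  (fun v => \sum_(i <- r) f i v) @ G --> \sum_(i <- r) l i.
Proof.
elim: r => [_|i r IH H].
  rewrite big_nil (_ : (fun _ => _) = fun=> 0); first exact: cvg_cst.
  by apply/funext => v; rewrite big_nil.
rewrite big_cons (_ : (fun _ => _) = fun v => f i v + \sum_(j <- r) f j v).
  apply: cvgD; first by apply: H; exact: mem_head.
  by apply: IH => j jr; apply: H; rewrite inE jr orbT.
by apply/funext => v; rewrite big_cons.
Qed.

Section Completeness.
Variables (G : set_system ctrl_path) (GG : ProperFilter G) (Gc : cauchy G).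

Let Gnrm (e : R) : 0 < e ->
  \forall z \near G, \forall z' \near G, ctrl_nrm (z - z') < e.
Proof.
move=> e0; apply: nearP_dep.
have /cauchy_ballP /(_ e e0) := Gc.
by apply: filterS => -[z z'] /=; rewrite -ball_normE.
Qed.

Let coord t h (z : ctrl_path) : R := mcoeff h (z t).

Let coord_cvg t h : cvg (coord t h @ G).
Proof.
apply: cauchy_cvg; apply/cauchy_ballP => e e0.
have [C C0 CP] := ctrl_bound t h.
have C1 : 0 < C + 1 by rewrite ltr_wpDl.
have /cauchy_ballP /(_ _ (divr_gt0 e0 C1)) := Gc.
move=> [[P Q] [/= GP GQ] PQ].
exists (coord t h @` P, coord t h @` Q).
  split; [apply: (filterS _ GP) | apply: (filterS _ GQ)] => z Pz /=;
    by exists z.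
move=> [_ _] /= [[z Pz <-] [z' Qz' <-]].
have := PQ (z, z') (conj Pz Qz'); rewrite -!ball_normE /=.
rewrite ctrl_normE ltr_pdivlMr // => lt; apply: le_lt_trans lt.
have -> : coord t h z - coord t h z' = mcoeff h ((z - z') t).
  by rewrite /coord /= mcoeffB.
apply: le_trans (CP _) _; rewrite mulrC ler_wpM2l ?ctrl_nrm_ge0 //.
by rewrite lerDl.
Qed.

Let l t h : R := lim (coord t h @ G).
Let Z t : halg A R := \sum_(h <- fset_set F) mkmalgU h (l t h).

Let msuppZ t : fsubset (msupp (Z t)) (fset_set F).
Proof.
apply/fsubsetP => k; apply: contraTT => kF; rewrite -mcoeff_eq0 /Z raddf_sum /=.
rewrite big_seq big1 // => h hF; rewrite mcoeffU; case: eqVneq => // hk.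
by move: kF; rewrite -hk hF.
Qed.

Let coeffZ t h : F h -> mcoeff h (Z t) = l t h.
Proof.
move=> hF; rewrite /Z raddf_sum /=.
rewrite (eq_bigr (fun k => l t k *+ (k == h))); last first.
  by move=> k _; exact: mcoeffU.
rewrite (big_fsetD1 h) /=; last first.
  by rewrite in_fset_set ?inE //; exact: finite_forests_le.
rewrite eqxx big_seq big1; first by rewrite addr0.
by move=> k; rewrite in_fsetD1 => /andP[/negPf ->].
Qed.

Let cvgZ t h : F h -> coord t h @ G --> mcoeff h (Z t).
Proof. by move=> hF; rewrite coeffZ //; exact: coord_cvg. Qed.

Let cvgR h s t : F h -> (fun z : ctrl_path => remainder z h s t) @ G -->
  remainder Z h s t.
Proof.
move=> hF; rewrite /remainder; apply: cvgB; first exact: cvgZ.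
rewrite (star_sum _ _ (msuppZ s)).
rewrite (_ : (fun z : ctrl_path => _) = (fun z : ctrl_path =>
  \sum_(k <- fset_set F)
    coord s k z * star (X s t) (mcoeff h) (fvec R k))); last first.
  by apply/funext => z; rewrite (star_sum _ _ (ctrl_supp z s)).
apply: cvg_rsum => k kF; apply: cvgM; last exact: cvg_cst.
apply: cvgZ; move: kF; rewrite in_fset_set ?inE //; exact: finite_forests_le.
Qed.

Let cvg_dist_le (a M y : R) (f : ctrl_path -> R) : f @ G --> y ->
  (\forall z \near G, `|a - f z| <= M) -> `|a - y| <= M.
Proof.
move=> fy; apply: cvgr_to_le.
exact: (cvg_norm (cvgB (cvg_cst a) fy)).
Qed.

Let remB (Z1 Z2 : time T -> halg A R) h s t :
  remainder (Z1 - Z2) h s t = remainder Z1 h s t - remainder Z2 h s t.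
Proof.
have -> : Z1 - Z2 = (- 1) *: Z2 + Z1 by rewrite scaleN1r addrC.
by rewrite remainderP mulN1r addrC.
Qed.

Let Znear (e : R) : 0 < e ->
  \forall z \near G, (ctrl_norm (val z - Z)%R
    <= ((e + e) *+ size (fset_set F))%:E)%E.
Proof.
move=> e0; apply: filterS (Gnrm e0) => z zP.
apply: ctrl_norm_le; first exact: ltW.
- move=> h hF; rewrite mcoeffB.
  apply: (cvg_dist_le (cvgZ (t := time0 T) hF)).
  apply: filterS zP => z' /ltW zz'; apply: le_trans zz'.
  have := ctrl_bound0 (z - z') hF.
  by rewrite /= mcoeffB.
- move=> h hF s t st; rewrite remB.
  apply: (cvg_dist_le (cvgR (s := s) (t := t) hF)).
  apply: filterS zP => z' /ltW zz'; rewrite /= -remB.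
  apply: le_trans (ctrl_boundR (z - z') hF st) _.
  by apply: ler_wpM2r => //; exact: powR_ge0.
Qed.

Let Zctrl : Z \in controlled.
Proof.
have [z zP] := filter_ex (Znear ltr01).
have zZ : val z - Z \in controlled.
  apply/controlledP; split; last by apply: le_lt_trans zP _; rewrite ltry.
  move=> t h /(fsubsetP (msuppB_le _ _)); rewrite in_fsetU.
  move=> /orP[/(fsubsetP (ctrl_supp z t))|/(fsubsetP (msuppZ t))];
    rewrite in_fset_set ?inE //; exact: finite_forests_le.
have -> : Z = val z - (val z - Z) by rewrite opprB addrC subrK.
by rewrite rpredB //; exact: (valP z).
Qed.

Lemma ctrl_cvg : cvg G.
Proof.
apply/cvg_ex; exists (CtrlPath Zctrl); apply/cvg_ballP => e e0.
set n := size (fset_set F).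
have d0 : 0 < e / (2 * n.+1%:R) by rewrite divr_gt0 // mulr_gt0.
apply: filterS (Znear d0) => z zP; rewrite -ball_normE /= distrC ctrl_normE.
rewrite -lte_fin ctrl_nrmE; apply: le_lt_trans zP _; rewrite lte_fin -/n.
rewrite -mulr2n -mulrnA -[X in X *+ _]mulr1 -mulrnAr -mulrA gtr_pMr //.
by rewrite mulrC ltr_pdivrMr ?mulr_gt0 // mul1r natrM ltr_pM2l // ltr_nat.
Qed.
End Completeness.

HB.instance Definition _ := Uniform_isComplete.Build ctrl_path ctrl_cvg.

End ControlledPaths.

Record continuous_field (R : realType) (S : topologicalType)
    (E : S -> completeNormedModType R) (Gamma : set (forall t, E t)) : Prop :=
  ContinuousField {
    cf_zero : Gamma (fun t => 0);
    cf_linear : forall (c : R) gamma delta, Gamma gamma -> Gamma delta ->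
      Gamma (fun t => c *: gamma t + delta t);
    cf_dense : forall t, dense [set gamma t | gamma in Gamma];
    cf_continuous : forall gamma, Gamma gamma ->
      continuous (fun t => `|gamma t|);
    cf_local : forall delta : (forall t, E t),
      (forall (t : S) (e : R), 0 < e ->
        exists2 gamma, Gamma gamma &
          \forall x \near t, `|delta x - gamma x| <= e) ->
      Gamma delta
  }.

(* Main.v *)
(* The space of sections is Gamma = the sections X |-> Z^X such that, as Y tends
   to X, the initial values of Z^Y converge to those of Z^X and the remainders
   of Z^Y (taken along Y) converge to those of Z^X (taken along X) in the
   Hoelder seminorms.  Linearity, continuity of the norms and local completeness
   of Gamma are then 3-epsilon arguments; the content is that the sections are
   pointwise dense, and in fact a section passes through every Z in D_X0.

   Such a section is built one degree at a time, from the highest to the lowest.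
   If the components of degree > |h| are known along Y, the germ
   Xi^Y_{s,t} = sum_k Z^{Y,k}_s <Y_{s,t} * h, k> satisfies
   Xi_{s,t} - Xi_{s,u} - Xi_{u,t} = - sum_{|j| > |h|} R^{Y,j}_{s,u} <Y_{u,t} * h, j>,
   which is of order g = (N - |h|) alpha.  Since alpha is not some 1/n, g < 1, and
   in this range a dyadic construction gives a linear operator L such that
   L(Xi)_t - L(Xi)_s - Xi_{s,t} = O(|t - s|^g).  The component of degree |h| is
   Z^{Y,h} = Z^h + L(Xi^Y) - L(Xi^X0), which is Z^h at Y = X0 and depends in a
   locally Lipschitz way on Y. *)
Require Import Defs.
From HB Require Import structures.
From mathcomp Require Import all_boot all_order all_algebra finmap.
From mathcomp Require Import all_classical all_reals interval_inference.
From mathcomp Require Import ereal topology normedtype sequences exp.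
From mathcomp Require Import ring lra zify.
From mathcomp Require monalg.
Import -(notations) monalg.
Set Implicit Arguments.
Unset Strict Implicit.
Unset Printing Implicit Defensive.
Import Order.TTheory GRing.Theory Num.Theory numFieldNormedType.Exports.
Local Open Scope classical_set_scope.
Local Open Scope ring_scope.

(** * Dyadic sewing below exponent 1 *)

Section Sewing.
Variables (R : realType) (T : {posnum R}).
Implicit Types (A B : time T -> time T -> R) (s u t : time T) (M g : R).

(** * Dyadic grids of [[0, T]] *)

Lemma clamp_subproof (x : R) : 0 <= Num.max 0 (Num.min x T%:num) <= T%:num.
Proof. by rewrite le_max lexx /= ge_max ge0 ge_min lexx orbT. Qed.

(** Clamping makes [grid n i] total in [i]: nodes beyond the right end collapse onto [T], so the
    dyadic recursion needs no range condition on the index. *)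
Definition clamp (x : R) : time T :=
  exist _ (Num.max 0 (Num.min x T%:num)) (clamp_subproof x).

Lemma clamp_id (x : R) : 0 <= x <= T%:num -> val (clamp x) = x.
Proof. by case/andP=> x0 xT /=; rewrite (min_idPl xT) (max_idPr x0). Qed.

Lemma clamp_lip (x y d : R) : x <= y -> y - x <= d ->
  `|val (clamp y) - val (clamp x)| <= d.
Proof.
move=> xy yx; have : 0 < T%:num by [].
rewrite /= ler_norml; set z := T%:num => z0.
by case: (leP x z) => ?; case: (leP y z) => ?; case: (leP 0 x) => ?;
  case: (leP 0 y) => ?; rewrite ?(max_idPr (ltW z0)); lra.
Qed.

Definition mesh n : R := T%:num / 2 ^+ n.

Definition grid n i : time T := clamp (mesh n * i%:R).

Lemma mesh_gt0 n : 0 < mesh n. Proof. by rewrite divr_gt0. Qed.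

Lemma mesh_ge0 n : 0 <= mesh n. Proof. exact/ltW/mesh_gt0. Qed.

Lemma meshS n : mesh n = 2 * mesh n.+1.
Proof. by rewrite /mesh exprS; field; rewrite expf_neq0. Qed.

Lemma grid_double n i : grid n.+1 i.*2 = grid n i.
Proof. by rewrite /grid (meshS n) -mul2n natrM mulrA [_ * 2]mulrC. Qed.

Lemma grid_step n i : `|val (grid n i.+1) - val (grid n i)| <= mesh n.
Proof.
have m0 := mesh_ge0 n.
by apply: clamp_lip; rewrite -natr1 mulrDr mulr1; lra.
Qed.

Lemma mesh_lt (d : R) : 0 < d -> exists n, mesh n < d.
Proof.
move=> d0; have Td0 : 0 <= T%:num / d by rewrite divr_ge0 // ltW.
exists (Num.bound (T%:num / d)).
rewrite /mesh ltr_pdivrMr ?exprn_gt0 // mulrC -ltr_pdivrMr //.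
apply: lt_le_trans (archi_boundP Td0) _.
by rewrite -natrX ler_nat ltnW // ltn_expl.
Qed.

Lemma mesh_scale (d : R) : 0 < d <= T%:num ->
  exists n, mesh n.+1 < d <= mesh n.
Proof.
case/andP=> d0 dT; have ex := mesh_lt d0.
case: (ex_minnP ex) => -[|n] nd nmin.
  by move: nd; rewrite /mesh expr0 divr1 ltNge dT.
exists n; rewrite nd leNgt /=; apply/negP => /nmin.
by rewrite ltnn.
Qed.

Definition cell n t : nat := Num.truncn (val t / mesh n).

Lemma cell_itv n t : mesh n * (cell n t)%:R <= val t < mesh n * (cell n t).+1%:R.
Proof.
have t0 : 0 <= val t / mesh n.
  by case: t => t /= /andP[t0 _]; rewrite divr_ge0 // mesh_ge0.
have := truncn_itv t0.
by rewrite ler_pdivlMr ?mesh_gt0 // ltr_pdivrMr ?mesh_gt0 // ![_ * mesh n]mulrC.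
Qed.

Lemma grid_cell n t : val (grid n (cell n t)) = mesh n * (cell n t)%:R.
Proof.
have /andP[l _] := cell_itv n t.
rewrite clamp_id // mulr_ge0 ?mesh_ge0 //=.
by apply: le_trans l _; case: (t) => ? /= /andP[].
Qed.

Lemma grid_cell_itv n t :
  val (grid n (cell n t)) <= val t < val (grid n (cell n t)) + mesh n.
Proof.
have := cell_itv n t.
by rewrite grid_cell -natr1 mulrDr mulr1.
Qed.

Lemma grid_cell_dist n t : `|val t - val (grid n (cell n t))| <= mesh n.
Proof. have := grid_cell_itv n t; rewrite ler_norml; lra. Qed.

Lemma cell0 n : cell n (time0 T) = 0%N.
Proof. by rewrite /cell /= mul0r; exact: truncn0. Qed.

Lemma cellS n t : cell n.+1 t = (cell n t).*2 \/ cell n.+1 t = (cell n t).*2.+1.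
Proof.
have := cell_itv n t; have := cell_itv n.+1 t.
set i := cell n t; set j := cell _ _; rewrite (meshS n).
move: (mesh n.+1) (mesh_gt0 n.+1) => m m0.
rewrite [2 * m]mulrC -!mulrA => /andP[a b] /andP[c d].
have : (i.*2 <= j)%N.
  rewrite -ltnS -(ltr_nat R) -(ltr_pM2l m0) -mul2n natrM.
  exact: le_lt_trans c b.
have : (j < i.+1.*2)%N.
  rewrite -(ltr_nat R) -(ltr_pM2l m0) -mul2n natrM.
  exact: le_lt_trans a d.
lia.
Qed.

Lemma cell_near n s t : `|val t - val s| <= mesh n ->
  [\/ cell n t = cell n s, cell n t = (cell n s).+1 | cell n s = (cell n t).+1].
Proof.
move=> ts.
have := cell_itv n t; have := cell_itv n s.
move: ts; rewrite ler_norml.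
set i := cell n t; set j := cell _ _; set m := mesh _.
move=> /andP[ts st] /andP[a b] /andP[c d].
have m0 : 0 < m by exact: mesh_gt0.
have h1 : (i < j.+2)%N.
  rewrite -(ltr_nat R) -(ltr_pM2l m0) -natr1 mulrDr mulr1; lra.
have h2 : (j < i.+2)%N.
  rewrite -(ltr_nat R) -(ltr_pM2l m0) -natr1 mulrDr mulr1; lra.
have [e|[e|e]] : i = j \/ i = j.+1 \/ j = i.+1 by lia.
- exact: Or31.
- exact: Or32.
- exact: Or33.
Qed.

(* On the new points of level n+1 the defect of additivity is split evenly
   between the two halves of the interval. *)
Fixpoint dyadic A n (i : nat) : R :=
  if n is m.+1 then
    if odd i then
      (dyadic A m i./2 + A (grid m i./2) (grid n i)
       + dyadic A m i./2.+1 - A (grid n i) (grid m i./2.+1)) / 2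
    else dyadic A m i./2
  else \sum_(j < i) A (grid 0 j) (grid 0 j.+1).

Definition sew_approx A n t : R :=
  dyadic A n (cell n t) + A (grid n (cell n t)) t.

Definition sew A t : R := limn (fun n => sew_approx A n t).

Lemma dyadicB A B n i :
  dyadic (fun s t => A s t - B s t) n i = dyadic A n i - dyadic B n i.
Proof.
elim: n i => [|n IH] i /=; first by rewrite sumrB.
by rewrite !IH; case: ifP => // _; rewrite -mulrBl; congr (_ / 2); ring.
Qed.

Lemma sew_approxB A B n t :
  sew_approx (fun s t => A s t - B s t) n t = sew_approx A n t - sew_approx B n t.
Proof. rewrite /sew_approx dyadicB; ring. Qed.

(** The three times come in any order, which is needed when two times in adjacent cells are compared
    through the grid point between them. Any common bound [l] on the two increments is allowed, so
    both can be measured by the mesh. *)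
Definition coherent g M A := forall s u t (l : R), 0 <= l ->
  `|val u - val s| <= l -> `|val t - val u| <= l ->
  `|A s t - A s u - A u t| <= M * l `^ g.

(** * Convergence of the dyadic scheme for coherent germs of exponent in (0, 1) *)

Variable g : R.
Hypotheses (g0 : 0 < g) (g1 : g < 1).

Lemma powR2_gt1 : 1 < 2 `^ g :> R.
Proof.
have := @gt0_ltr_powR R g g0 1 2; rewrite !nnegrE powR1; apply => //.
by rewrite ltr1n.
Qed.

Lemma powR2_lt2 : 2 `^ g < 2 :> R.
Proof.
rewrite /powR gt_eqF // -[ltRHS](@lnK R) ?posrE // ltr_expR gtr_pMl //.
by rewrite ln_gt0 // ltr1n.
Qed.

Lemma meshS_powR n : mesh n `^ g = 2 `^ g * mesh n.+1 `^ g.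
Proof. by rewrite meshS powRM // mesh_ge0. Qed.

Section Coherent.
Variables (A : time T -> time T -> R) (M : R).
Hypothesis cA : coherent g M A.

Lemma coherent_ge0 : 0 <= M.
Proof.
have := @cA (time0 T) (time0 T) (time0 T) 1.
rewrite subrr normr0 powR1 mulr1 => /(_ ler01 ler01 ler01).
exact: le_trans.
Qed.

(** At three equal times the choice [l = 0] is admissible, and zero to the positive power [g] is
    zero. *)
Lemma coherent_diag s : A s s = 0.
Proof.
have := @cA s s s 0 (lexx 0); rewrite subrr normr0 => /(_ (lexx 0) (lexx 0)).
rewrite powR0 ?gt_eqF // mulr0 normr_le0 subrr sub0r oppr_eq0.
exact/eqP.
Qed.

(** The solution [c] of [c * 2^g + 1 = 2 * c], the balance that closes the induction on the defect;
    it is positive because [g < 1]. *)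
Definition sew_c : R := (2 - 2 `^ g)^-1.

Lemma sew_c_ge0 : 0 <= sew_c.
Proof. by rewrite invr_ge0 subr_ge0 ltW // powR2_lt2. Qed.

(** By the choice of the midpoint value, both halves of a parent interval have the same defect
    [(D + E) / 2], where [D] is the defect of the parent and [E] the failure of additivity of [A] at
    the midpoint. Halving beats the growth factor [2^g] of the bound, so the constant does not
    deteriorate with the level. *)
Lemma dyadic_defect n i :
  `|dyadic A n i.+1 - dyadic A n i - A (grid n i) (grid n i.+1)|
    <= sew_c * M * mesh n `^ g.
Proof.
have M0 := coherent_ge0.
elim: n i => [|n IH] i.
  rewrite /= big_ord_recr /= (_ : _ - _ - _ = 0) ?normr0; last by ring.
  by rewrite !mulr_ge0 ?sew_c_ge0 ?powR_ge0.
pose j := i./2.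
pose D := dyadic A n j.+1 - dyadic A n j - A (grid n j) (grid n j.+1).
pose u := grid n.+1 j.*2.+1.
pose E := A (grid n j) (grid n j.+1) - A (grid n j) u - A u (grid n j.+1).
have -> : dyadic A n.+1 i.+1 - dyadic A n.+1 i - A (grid n.+1 i) (grid n.+1 i.+1)
    = (D + E) / 2.
  have := odd_double_half i; rewrite -/j /D /E /u => <-.
  case: (odd i); rewrite /= ?negbK !odd_double /= ?uphalf_double ?doubleK.
    by rewrite -doubleS !grid_double; field.
  by rewrite !grid_double; field.
rewrite normrM normfV [ `|2| ]ger0_norm // ler_pdivrMr //.
apply: le_trans (ler_normD _ _) _.
have -> : sew_c * M * mesh n.+1 `^ g * 2 =
   sew_c * M * mesh n `^ g + M * mesh n.+1 `^ g.
  rewrite (meshS_powR n) /sew_c; field; have := powR2_lt2; lra.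
apply: lerD; first exact: IH.
apply: cA; first exact: mesh_ge0.
  by rewrite -grid_double; exact: grid_step.
by rewrite -grid_double doubleS; exact: grid_step.
Qed.

(** If [t] lies in the left half of its cell the base point and its value persist and nothing
    changes. Otherwise the change is a dyadic defect at level [n.+1] minus one coherence defect. *)
Lemma sew_approx_step n t :
  `|sew_approx A n.+1 t - sew_approx A n t| <= (sew_c + 1) * M * mesh n.+1 `^ g.
Proof.
have M0 := coherent_ge0.
rewrite /sew_approx; have [e|e] := cellS n t.
  rewrite e grid_double /= odd_double doubleK subrr normr0.
  by rewrite !mulr_ge0 ?powR_ge0 // addr_ge0 ?sew_c_ge0.
have gd := @grid_cell_dist n.+1 t; move: gd; rewrite e.
set i := cell n t; set u := grid n.+1 _ => gd.
have -> : dyadic A n.+1 i.*2.+1 + A u t - (dyadic A n i + A (grid n i) t) =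
   (dyadic A n.+1 i.*2.+1 - dyadic A n.+1 i.*2 - A (grid n.+1 i.*2) u)
   - (A (grid n i) t - A (grid n i) u - A u t).
  rewrite grid_double [dyadic A n.+1 i.*2]/= odd_double doubleK; ring.
apply: le_trans (ler_normB _ _) _; rewrite !mulrDl mul1r; apply: lerD.
  exact: dyadic_defect.
apply: cA => //; first exact: mesh_ge0.
by rewrite -grid_double; exact: grid_step.
Qed.

(** Sum of the geometric series of the step bounds: [sew_b * mesh n ^ g] dominates all steps from
    level [n] on, and its increments are exactly these bounds. *)
Definition sew_b : R := (sew_c + 1) * M / (2 `^ g - 1).

Lemma sew_b_ge0 : 0 <= sew_b.
Proof.
apply: divr_ge0; last by rewrite subr_ge0 ltW // powR2_gt1.
by rewrite mulr_ge0 ?coherent_ge0 // addr_ge0 ?sew_c_ge0.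
Qed.

Lemma sew_approx_stepE n t : `|sew_approx A n.+1 t - sew_approx A n t|
   <= sew_b * mesh n `^ g - sew_b * mesh n.+1 `^ g.
Proof.
apply: le_trans (sew_approx_step n t) _; rewrite (meshS_powR n) /sew_b.
rewrite le_eqVlt; apply/orP; left; apply/eqP; field.
have := powR2_gt1; lra.
Qed.

Lemma sew_approx_dist n k t : `|sew_approx A (n + k) t - sew_approx A n t|
   <= sew_b * mesh n `^ g - sew_b * mesh (n + k) `^ g.
Proof.
elim: k => [|k IH]; first by rewrite addn0 !subrr normr0.
have := ler_normD (sew_approx A (n + k).+1 t - sew_approx A (n + k) t)
  (sew_approx A (n + k) t - sew_approx A n t).
rewrite addrA subrK addnS => /le_trans; apply.
have := sew_approx_stepE (n + k) t; lra.
Qed.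

(** With [a] decreasing and dominating the steps, adding [a] turns the approximations into a
    nonincreasing sequence bounded below; they are thus the difference of two convergent monotone
    sequences. *)
Lemma sew_approx_cvg t : cvgn (fun n => sew_approx A n t).
Proof.
pose a n := sew_b * mesh n `^ g.
have a0 n : 0 <= a n by rewrite mulr_ge0 ?sew_b_ge0 ?powR_ge0.
have step n : `|sew_approx A n.+1 t - sew_approx A n t| <= a n - a n.+1.
  exact: sew_approx_stepE.
have ca : cvgn a.
  apply: nonincreasing_is_cvgn; last by exists 0 => _ [n _ <-].
  apply/nonincreasing_seqP => n; have := step n.
  by move=> h; have := le_trans (normr_ge0 _) h; lra.
have cu : cvgn (fun n => sew_approx A n t + a n).
  apply: nonincreasing_is_cvgn.
    by apply/nonincreasing_seqP => n; have := step n; rewrite ler_norml; lra.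
  exists (sew_approx A 0 t - a 0) => _ [n _ <-].
  have := sew_approx_dist 0 n t; rewrite add0n -!/(a _) ler_norml.
  have := a0 n; lra.
have -> : (fun n => sew_approx A n t) = (fun n => sew_approx A n t + a n) \- a.
  by apply/funext => n /=; rewrite addrK.
exact: is_cvgB.
Qed.

Lemma sew_dist n t : `|sew A t - sew_approx A n t| <= sew_b * mesh n `^ g.
Proof.
have c : (fun m => sew_approx A m t) @ \oo --> sew A t.
  exact: sew_approx_cvg.
have cd : (fun m => `|sew_approx A m t - sew_approx A n t|) @ \oo
    --> `|sew A t - sew_approx A n t|.
  by apply: cvg_norm; apply: cvgB c _; exact: cvg_cst.
apply: cvgr_to_le cd _; exists n => //= m nm.
have := sew_approx_dist n (m - n) t; rewrite subnKC // => /le_trans; apply.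
by rewrite lerBlDr lerDl mulr_ge0 ?sew_b_ge0 ?powR_ge0.
Qed.

(** At this scale [s] and [t] lie in the same or in adjacent cells, so at most one dyadic defect and
    two coherence defects occur. *)
Lemma sew_approx_near n s t : `|val t - val s| <= mesh n ->
  `|sew_approx A n t - sew_approx A n s - A s t| <= (sew_c + 2) * M * mesh n `^ g.
Proof.
move=> ts; have M0 := coherent_ge0; have m0 := mesh_ge0 n.
have gs := grid_cell_itv n s; have gt := grid_cell_itv n t.
have gsd := grid_cell_dist n s; have gtd := grid_cell_dist n t.
have mg := @powR_ge0 R (mesh n) g; have c0 := sew_c_ge0.
have Mm : 0 <= M * mesh n `^ g by rewrite mulr_ge0.
have cMm : 0 <= sew_c * (M * mesh n `^ g) by rewrite mulr_ge0.
rewrite /sew_approx; case: (cell_near ts) => e; move: gs gt gsd gtd; rewrite e.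
- set i := cell n s; set a := grid n i => gs gt gsd gtd.
  have := cA m0 gsd ts.
  rewrite !ler_norml; lra.
- set i := cell n s; set a := grid n i; set b := grid n i.+1 => gs gt gsd gtd.
  have h1 := cA m0 gsd ts.
  have h2 := cA m0 (grid_step n i) gtd.
  have h3 := dyadic_defect n i.
  move: h1 h2 h3; rewrite -/a -/b !ler_norml; lra.
- set i := cell n t; set b := grid n i; set a := grid n i.+1 => gs gt gsd gtd.
  have ba := grid_step n i; rewrite -/a -/b in ba.
  (* Both [a] and [b] are base points of actual cells, so clamping does not move them and [a] is
     exactly one mesh to the right of [b], with [t] in between. *)
  have ta : `|val t - val a| <= mesh n.
    have := grid_cell n s; rewrite e -/i -/a -natr1 mulrDr mulr1 => ea.
    have := grid_cell n t; rewrite -/i -/b => eb.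
    by move: ts gs gt gsd gtd; rewrite !ler_norml; lra.
  have h1 := cA m0 gsd ts.
  have h2 := cA m0 ba ta.
  have h3 := dyadic_defect n i.
  move: h1 h2 h3; rewrite -/a -/b !ler_norml; lra.
Qed.

End Coherent.

(** One comparison at the scale of the increment plus two tails of the approximation; the factor
    [2^g] pays for replacing the mesh, less than twice the increment, by the increment. *)
Definition sew_const : R :=
  (sew_c + 2 + 2 * ((sew_c + 1) / (2 `^ g - 1))) * 2 `^ g.

Lemma sew_const_ge0 : 0 <= sew_const.
Proof.
have := powR2_gt1; have := sew_c_ge0 => c0 p1.
have p0 : 0 <= (2 `^ g - 1)^-1 :> R by rewrite invr_ge0; lra.
by rewrite mulr_ge0 ?addr_ge0 ?mulr_ge0 //; lra.
Qed.

Lemma sew0 A : sew A (time0 T) = A (time0 T) (time0 T).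
Proof.
rewrite /sew; have -> : (fun n => sew_approx A n (time0 T)) =
    fun=> A (time0 T) (time0 T); last exact: lim_cst.
apply/funext => n; rewrite /sew_approx cell0.
have -> : grid n 0 = time0 T.
  by apply: val_inj; rewrite /grid mulr0 clamp_id //= lexx ge0.
have -> : dyadic A n 0 = 0; last by rewrite add0r.
by elim: n => //=; rewrite big_ord0.
Qed.

Lemma sewB A B M M' t : coherent g M A -> coherent g M' B ->
  sew (fun s t => A s t - B s t) t = sew A t - sew B t.
Proof.
move=> cA cB; rewrite /sew -limB.
- by congr (limn _); apply/funext => n; rewrite sew_approxB.
- exact: (sew_approx_cvg cA).
- exact: (sew_approx_cvg cB).
Qed.

Lemma sew_bound A M s t : coherent g M A ->
  `|sew A t - sew A s - A s t| <= sew_const * M * `|val t - val s| `^ g.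
Proof.
move=> cA; have M0 := coherent_ge0 cA.
have [<-|st] := eqVneq s t.
  rewrite subrr sub0r (coherent_diag cA) oppr0 normr0.
  by rewrite mulr_ge0 ?powR_ge0 // mulr_ge0 ?sew_const_ge0.
have : 0 < `|val t - val s| <= T%:num.
  rewrite normr_gt0 subr_eq0 (inj_eq val_inj) eq_sym st /=.
  case: (s) (t) => [a /= ha] [b /= hb]; rewrite ler_norml; lra.
case/mesh_scale => n /andP[n1 n2].
apply: (@le_trans _ _ ((sew_c + 2) * M * mesh n `^ g
  + 2 * (sew_b M * mesh n `^ g))).
  have := sew_dist cA n s; have := sew_dist cA n t.
  have := sew_approx_near cA n2.
  rewrite !ler_norml; lra.
have : 2 `^ g * mesh n.+1 `^ g <= 2 `^ g * `|val t - val s| `^ g.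
  rewrite ler_wpM2l ?powR_ge0 // ge0_ler_powR ?ltW // nnegrE ?normr_ge0 //.
  exact: mesh_ge0.
rewrite -meshS_powR => h.
rewrite /sew_b /sew_const.
set q := (2 `^ g - 1)^-1.
have q0 : 0 <= q by rewrite invr_ge0; have := powR2_gt1; lra.
have c0 := sew_c_ge0.
have -> : (sew_c + 2) * M * mesh n `^ g + 2 * ((sew_c + 1) * M * q * mesh n `^ g)
  = (sew_c + 2 + 2 * ((sew_c + 1) * q)) * M * mesh n `^ g by ring.
rewrite [leRHS](_ : _ = (sew_c + 2 + 2 * ((sew_c + 1) * q)) * M *
   (2 `^ g * `|val t - val s| `^ g)); last by ring.
apply: ler_wpM2l h; rewrite !mulr_ge0 ?addr_ge0 ?mulr_ge0 //; lra.
Qed.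

(** Below exponent 1 a function with this local expansion is not unique, but the dyadic choice is
    linear in the germ. Hence the error depends on the germ in a Lipschitz way, with the constant
    [M''] of the difference. *)
Lemma sew_bound2 A B M M' M'' s t : coherent g M A -> coherent g M' B ->
  coherent g M'' (fun s t => A s t - B s t) ->
  `|(sew A t - sew A s - A s t) - (sew B t - sew B s - B s t)|
    <= sew_const * M'' * `|val t - val s| `^ g.
Proof.
move=> cA cB cAB; have := sew_bound s t cAB.
rewrite !(sewB _ cA cB).
by congr (_ <= _); congr `|_|; ring.
Qed.

End Sewing.

(** * Uniform constants over finite index lists *)

Lemma seq_bound (R : realDomainType) (I : eqType) (r : seq I) (P : I -> R -> Prop) :
  (forall i x y, x <= y -> P i x -> P i y) ->
  {in r, forall i, exists c, P i c} ->
  exists2 c, 0 <= c & {in r, forall i, P i c}.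
Proof.
move=> mono; elim: r => [|i r IH] H; first by exists 0.
have [c c0 cP] : exists2 c, 0 <= c & {in r, forall i, P i c}.
  by apply: IH => j jr; apply: H; rewrite inE jr orbT.
have [b bP] := H i (mem_head _ _).
exists (Num.max b c) => [|j]; first by rewrite le_max c0 orbT.
rewrite inE => /predU1P[->|/cP jc].
  by apply: mono bP; rewrite le_max lexx.
by apply: mono jc; rewrite le_max lexx orbT.
Qed.

Lemma ler_norm_sum_seq (R : numDomainType) (I : eqType) (r : seq I) (P : pred I)
    (f : I -> R) (c : R) : 0 <= c -> {in r, forall i, P i -> `|f i| <= c} ->
  `|\sum_(i <- r | P i) f i| <= (size r)%:R * c.
Proof.
move=> c0 H; apply: le_trans (ler_norm_sum _ _ _) _.
rewrite big_seq_cond; apply: (@le_trans _ _ (\sum_(i <- r | (i \in r) && P i) c)).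
  by apply: ler_sum => i /andP[ir Pi]; exact: H.
rewrite big_const_seq iter_addr addr0 mulr_natl; apply: ler_wpMn2l => //.
exact: count_size.
Qed.

Lemma seq_bound2 (R : realDomainType) (I : eqType) (r : seq I) (P : I -> I -> R -> Prop) :
  (forall i j x y, x <= y -> P i j x -> P i j y) ->
  {in r &, forall i j, exists c, P i j c} ->
  exists2 c, 0 <= c & {in r &, forall i j, P i j c}.
Proof.
move=> mono H.
have [c c0 cP] : exists2 c, 0 <= c & {in r, forall i, {in r, forall j, P i j c}}.
  apply: seq_bound => [i x y xy Px j jr|i ir]; first exact: mono (Px j jr).
  have [c _ cP] : exists2 c, 0 <= c & {in r, forall j, P i j c}.
    by apply: seq_bound => [j|j jr]; [exact: mono | exact: H].
  by exists c.
by exists c => // i j ir jr; exact: cP.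
Qed.

(** * Lifting through a triangular family of kernels *)

Section Lift.
Variables (R : realType) (T : {posnum R}) (S : Type) (I : eqType) (F : seq I).
Variables (d : I -> nat) (N : nat) (alpha : R).
Variables (G : S -> I -> I -> time T -> time T -> R) (dist : S -> S -> R).

Definition expo h : R := (N - d h)%:R * alpha.

(** Abstract form of the remainder of a controlled path: [w] collects the components and [G Y] is
    the matrix of the translation along [Y]. *)
Definition residual Y (w : I -> time T -> R) h (s t : time T) : R :=
  w h t - \sum_(k <- F) w k s * G Y h k s t.

Hypotheses (uF : uniq F) (dF : {in F, forall h, (d h < N)%N}).
Hypotheses (alpha0 : 0 < alpha) (alphaN : N%:R * alpha < 1).
Hypothesis G_low : forall Y s t, {in F &, forall h k, (d k <= d h)%N ->
  G Y h k s t = (h == k)%:R}.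
Hypothesis G_chen : forall Y s u t, {in F &, forall h k,
  G Y h k s t = \sum_(j <- F) G Y j k s u * G Y h j u t}.
Hypothesis G_bound : forall Y, exists2 C : R, 0 <= C & {in F &, forall h k,
  (d h <= d k)%N -> forall s t,
  `|G Y h k s t| <= C * `|val t - val s| `^ ((d k - d h)%:R * alpha)}.
Hypothesis dist_ge0 : forall Y Y', 0 <= dist Y Y'.
Hypothesis G_dist : exists2 C : R, 0 <= C & forall Y Y', {in F &, forall h k,
  (d h <= d k)%N -> forall s t,
  `|G Y h k s t - G Y' h k s t|
    <= C * dist Y Y' * `|val t - val s| `^ ((d k - d h)%:R * alpha)}.

Lemma expo_itv h : h \in F -> 0 < expo h < 1.
Proof.
move=> hF; have dh := dF hF; rewrite /expo mulr_gt0 ?ltr0n ?subn_gt0 //=.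
apply: le_lt_trans alphaN; rewrite ler_wpM2r ?(ltW alpha0) // ler_nat.
exact: leq_subr.
Qed.

(** The kernel is unitriangular for the degree, so a residual sees only its own component and those
    of higher degree. *)
Lemma residual_ext Y w w' h s t : h \in F ->
  {in F, forall k, (d h <= d k)%N -> w k =1 w' k} ->
  residual Y w h s t = residual Y w' h s t.
Proof.
move=> hF e; rewrite /residual (e h) //; congr (_ - _).
rewrite big_seq [RHS]big_seq; apply: eq_bigr => k kF.
have [hk|kh] := leqP (d h) (d k); first by rewrite e.
rewrite G_low ?(ltnW kh) //; case: eqVneq => [hk|_]; last by rewrite !mulr0.
by rewrite hk ltnn in kh.
Qed.

Definition germ Y w h s t : R := \sum_(k <- F) w k s * G Y h k s t.

(** The Chen relation expands the germ over [(s, t)] through [u], producing residuals over [(s, u)].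
    Since [w h] vanishes at [u], the residual at index [h] is minus the germ over [(s, u)]; lower
    degrees and other indices of equal degree drop out by triangularity. *)
Lemma germ_defect Y w h s u t : h \in F -> w h u = 0 ->
  germ Y w h s t - germ Y w h s u - germ Y w h u t =
  - \sum_(j <- F | (d h < d j)%N) residual Y w j s u * G Y h j u t.
Proof.
move=> hF wh.
have e1 : germ Y w h s t - germ Y w h u t = - \sum_(j <- F) residual Y w j s u * G Y h j u t.
  rewrite /germ -!sumrN.
  have -> : \sum_(k <- F) w k s * G Y h k s t =
      \sum_(j <- F) \sum_(k <- F) w k s * G Y j k s u * G Y h j u t.
    rewrite exchange_big /= big_seq [RHS]big_seq; apply: eq_bigr => k kF.
    by rewrite (G_chen Y s u t hF kF) mulr_sumr; apply: eq_bigr => j _; rewrite mulrA.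
  rewrite -big_split; apply: eq_bigr => j _; rewrite /residual mulrBl opprB /=.
  by rewrite mulr_suml.
have e2 : \sum_(j <- F) residual Y w j s u * G Y h j u t =
    \sum_(j <- F | (d h < d j)%N) residual Y w j s u * G Y h j u t - germ Y w h s u.
  rewrite (bigD1_seq h) //= addrC G_low // eqxx mulr1 {2}/residual wh sub0r.
  congr (_ - _); rewrite big_mkcond [RHS]big_mkcond.
  rewrite big_seq [RHS]big_seq; apply: eq_bigr => j jF.
  case: ltnP => hj; first by case: eqP => // jh; rewrite jh ltnn in hj.
  by rewrite G_low //; case: eqVneq => //=; rewrite mulr0.
by rewrite addrAC e1 e2 opprB addrAC subrr sub0r.
Qed.

Lemma powR_split (l : R) h j : h \in F -> j \in F -> (d h < d j)%N ->
  l `^ expo h = l `^ expo j * l `^ ((d j - d h)%:R * alpha).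
Proof.
move=> hF jF hj; have dj := dF jF; rewrite -powRD.
  by rewrite -mulrDl -natrD addnBA ?(ltnW hj) // subnK // ltnW.
rewrite gt_eqF //; have /andP[e0 _] := expo_itv jF.
by rewrite ltr_wpDr // mulr_ge0 // ltW.
Qed.

(** The constant may depend on [Y]; the Lipschitz estimate is required only on the unit ball around
    [Y]. This local form is what survives products of residuals and kernels. *)
Definition residual_ctrl (W : S -> I -> time T -> R) Y h (C : R) := forall s t,
  `|residual Y (W Y) h s t| <= C * `|val t - val s| `^ expo h /\
  forall Y', dist Y Y' <= 1 ->
    `|residual Y (W Y) h s t - residual Y' (W Y') h s t|
      <= C * dist Y Y' * `|val t - val s| `^ expo h.

Lemma residual_ctrl_mono W Y h (x y : R) : x <= y -> residual_ctrl W Y h x -> residual_ctrl W Y h y.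
Proof.
move=> xy H s t; have [H1 H2] := H s t; split=> [|Y' /H2 {}H2].
  by apply: le_trans H1 _; rewrite ler_wpM2r ?powR_ge0.
apply: le_trans H2 _; rewrite ler_wpM2r ?powR_ge0 //.
by rewrite ler_wpM2r.
Qed.

Lemma ler_powR_dist (e l : R) (s t : time T) : 0 <= e -> `|val t - val s| <= l ->
  `|val t - val s| `^ e <= l `^ e.
Proof.
move=> e0 tl; rewrite ge0_ler_powR // nnegrE //.
exact: le_trans tl.
Qed.

(** In [germ_defect] each residual has order [expo j] and each kernel entry order
    [(d j - d h) * alpha], which add up to [expo h]. Differences in [Y] are handled by the product
    rule for [a * b - a' * b']. *)
Lemma germ_coherent W h : h \in F -> (forall Y, W Y h =1 fun=> 0) ->
  (forall Y, {in F, forall j, (d h < d j)%N -> exists C, residual_ctrl W Y j C}) ->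
  forall Y, exists M,
    coherent (expo h) M (germ Y (W Y) h) /\
    forall Y', dist Y Y' <= 1 -> coherent (expo h) (M * dist Y Y')
      (fun s t => germ Y (W Y) h s t - germ Y' (W Y') h s t).
Proof.
move=> hF Wh H Y.
have [C C0 CP] : exists2 C : R, 0 <= C &
    {in F, forall j, (d h < d j)%N -> residual_ctrl W Y j C}.
  apply: seq_bound => [j x y xy P hj|j jF]; first exact: residual_ctrl_mono (P hj).
  case: (ltnP (d h) (d j)) => [hj|_]; last by exists 0.
  by have [C CP] := H Y j jF hj; exists C.
have [B B0 BP] := G_bound Y.
have [D D0 DP] := G_dist.
pose M := (size F)%:R * (C * B + 2 * C * D).
have sF : 0 <= (size F)%:R :> R by [].
have jh j : (0 : R) <= (d j - d h)%:R * alpha by rewrite mulr_ge0 // ltW.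
have je j : 0 <= expo j by rewrite mulr_ge0 // ltW.
exists M; split=> [s u t l l0 su ut|Y' YY' s u t l l0 su ut].
  rewrite germ_defect ?Wh // normrN /M -mulrA.
  apply: ler_norm_sum_seq => [|j jF hj].
    by rewrite mulr_ge0 ?powR_ge0 // addr_ge0 ?mulr_ge0.
  rewrite (powR_split _ hF jF hj) normrM.
  apply: (@le_trans _ _ ((C * l `^ expo j) * (B * l `^ ((d j - d h)%:R * alpha)))).
    apply: ler_pM => //.
      have [Cr _] := CP j jF hj s u.
      by apply: le_trans Cr _; rewrite ler_wpM2l // ler_powR_dist.
    apply: le_trans (BP h j hF jF (ltnW hj) u t) _.
    by rewrite ler_wpM2l // ler_powR_dist.
  rewrite mulrACA ler_wpM2r ?mulr_ge0 ?powR_ge0 //.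
  by rewrite lerDl !mulr_ge0.
have -> : germ Y (W Y) h s t - germ Y' (W Y') h s t -
    (germ Y (W Y) h s u - germ Y' (W Y') h s u) -
    (germ Y (W Y) h u t - germ Y' (W Y') h u t) =
    (germ Y (W Y) h s t - germ Y (W Y) h s u - germ Y (W Y) h u t) -
    (germ Y' (W Y') h s t - germ Y' (W Y') h s u - germ Y' (W Y') h u t).
  by ring.
rewrite !germ_defect ?Wh // -opprD normrN -sumrB /M -!mulrA.
apply: ler_norm_sum_seq => [|j jF hj].
  by rewrite !mulr_ge0 ?powR_ge0 // addr_ge0 ?mulr_ge0.
rewrite (powR_split _ hF jF hj).
set p := l `^ _; set q := l `^ _; set y := dist Y Y'.
have p0 : 0 <= p by exact: powR_ge0.
have q0 : 0 <= q by exact: powR_ge0.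
have y0 : 0 <= y by exact: dist_ge0.
have [Cr /(_ Y' YY') Cd] := CP j jF hj s u.
have {}Cr : `|residual Y (W Y) j s u| <= C * p.
  by apply: le_trans Cr _; rewrite ler_wpM2l // ler_powR_dist.
have {}Cd : `|residual Y (W Y) j s u - residual Y' (W Y') j s u| <= C * y * p.
  by apply: le_trans Cd _; rewrite ler_wpM2l ?mulr_ge0 // ler_powR_dist.
have Gb : `|G Y h j u t| <= B * q.
  apply: le_trans (BP h j hF jF (ltnW hj) u t) _.
  by rewrite ler_wpM2l // ler_powR_dist.
have Gd : `|G Y h j u t - G Y' h j u t| <= D * y * q.
  apply: le_trans (DP Y Y' h j hF jF (ltnW hj) u t) _.
  by rewrite ler_wpM2l ?mulr_ge0 // ler_powR_dist.
move: Cr Cd Gb Gd.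
set a := residual Y _ _ _ _; set a' := residual Y' _ _ _ _; set b := G Y _ _ _ _.
set b' := G Y' _ _ _ _ => Cr Cd Gb Gd.
(* The bound at [Y'] is transferred from [Y]: since [dist Y Y' <= 1], the difference costs at most
   another [C * p]. *)
have Cr' : `|a'| <= 2 * C * p.
  rewrite (_ : a' = a - (a - a')); last by ring.
  apply: le_trans (ler_normB _ _) _.
  rewrite (_ : 2 * C * p = C * p + C * 1 * p); last by ring.
  apply: lerD => //; apply: le_trans Cd _.
  by rewrite ler_wpM2r // ler_wpM2l.
rewrite (_ : a * b - a' * b' = (a - a') * b + a' * (b - b')); last by ring.
apply: le_trans (ler_normD _ _) _; rewrite !normrM.
rewrite [leRHS](_ : _ = (C * y * p) * (B * q) + (2 * C * p) * (D * y * q)); last by ring.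
by apply: lerD; apply: ler_pM.
Qed.

(** After [n] steps the components of degree at least [N - n] are built. The lower ones are kept at
    zero, as [germ_defect] requires for the next degree. *)
Record stage (X0 : S) (z0 : I -> time T -> R) n (W : S -> I -> time T -> R) : Prop := Stage {
  stage_low : forall Y, {in F, forall h, (d h + n < N)%N -> W Y h =1 fun=> 0};
  stage_init : forall Y, {in F, forall h, (N <= d h + n)%N ->
    W Y h (time0 T) = z0 h (time0 T)};
  stage_base : {in F, forall h, (N <= d h + n)%N -> W X0 h =1 z0 h};
  stage_ctrl : forall Y, {in F, forall h, (N <= d h + n)%N ->
    exists C, residual_ctrl W Y h C}
}.

Lemma stageS X0 z0 n W :
  {in F, forall h, exists C, forall s t,
    `|residual X0 z0 h s t| <= C * `|val t - val s| `^ expo h} ->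
  stage X0 z0 n W -> exists W', stage X0 z0 n.+1 W'.
Proof.
move=> z0C st.
(* Only degree [N - n.+1] is filled in; at [X0] the two sewn germs cancel and leave [z0 h]. *)
pose W' Y h t := if d h + n.+1 == N
  then z0 h t + sew (germ Y (W Y) h) t - sew (germ X0 (W X0) h) t else W Y h t.
have W'old Y h : (N <= d h + n)%N -> W' Y h =1 W Y h.
  by move=> Nh t; rewrite /W'; case: eqP => // e; lia.
have coh h : h \in F -> d h + n.+1 = N -> forall Y, exists M,
    coherent (expo h) M (germ Y (W Y) h) /\
    forall Y', dist Y Y' <= 1 -> coherent (expo h) (M * dist Y Y')
      (fun s t => germ Y (W Y) h s t - germ Y' (W Y') h s t).
  move=> hF hn; apply: germ_coherent => // [Y|Y j jF hj].
    by apply: (stage_low st) => //; lia.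
  by apply: (stage_ctrl st) => //; lia.
have W'base : {in F, forall h, (N <= d h + n.+1)%N -> W' X0 h =1 z0 h}.
  move=> h hF hn t; rewrite /W'; case: eqP => [e|ne]; first by rewrite addrK.
  by apply: (stage_base st) => //; lia.
(* The terms common to all parameters, [z0] and the sewn germ of [X0], cancel; what remains is a
   difference of two sewing errors. *)
have residual'D Y Y' h s t : h \in F -> d h + n.+1 = N ->
    residual Y (W' Y) h s t - residual Y' (W' Y') h s t =
    (sew (germ Y (W Y) h) t - sew (germ Y (W Y) h) s - germ Y (W Y) h s t)
    - (sew (germ Y' (W Y') h) t - sew (germ Y' (W Y') h) s - germ Y' (W Y') h s t).
  move=> hF hn.
  have remE Z : residual Z (W' Z) h s t = W' Z h t - W' Z h s - germ Z (W Z) h s t.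
    rewrite /residual -addrA -opprD; congr (_ - _).
    rewrite (bigD1_seq h) //= G_low // eqxx mulr1; congr (_ + _).
    rewrite /germ [RHS](bigD1_seq h) //=.
    have -> : W Z h s = 0 by apply: (stage_low st) => //; lia.
    rewrite mul0r add0r.
    (* Other components of the same degree have changed as well, but their kernel entry against [h]
       is zero. *)
    rewrite big_seq_cond [RHS]big_seq_cond; apply: eq_bigr => k /andP[kF kh].
    rewrite {1}/W'; case: eqP => // e.
    by rewrite G_low // 1?eq_sym ?(negbTE kh) ?mulr0 //; lia.
  by rewrite !remE /W' hn eqxx; ring.
have residual'old Y h s t : h \in F -> (N <= d h + n)%N ->
    residual Y (W' Y) h s t = residual Y (W Y) h s t.
  by move=> hF hn; apply: residual_ext => // k kF hk; apply: W'old; lia.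
exists W'; split=> // [Y h hF hn|Y h hF hn|Y h hF hn].
- by move=> t; rewrite /W'; case: eqP => [|_]; [lia | apply: (stage_low st) => //; lia].
- rewrite /W'; case: eqP => [e|ne]; last by apply: (stage_init st) => //; lia.
  have e0 : 0 < expo h by have /andP[] := expo_itv hF.
  rewrite !sew0.
  have [M [/(coherent_diag e0) -> _]] := coh h hF e Y.
  have [M' [/(coherent_diag e0) -> _]] := coh h hF e X0.
  by rewrite addrK.
- case: (eqVneq (d h + n.+1) N)%N => [e|ne]; last first.
    have hn' : (N <= d h + n)%N by lia.
    have [C CP] := stage_ctrl st Y hF hn'; exists C => s t.
    rewrite residual'old //; have [H1 H2] := CP s t; split=> // Y' YY'.
    by rewrite residual'old //; exact: H2.
  have /andP[e0 e1] := expo_itv hF.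
  have [M [cM dM]] := coh h hF e Y; have [M0 [cM0 _]] := coh h hF e X0.
  have [C CP] := z0C h hF.
  pose K := sew_const (expo h).
  have K0 : 0 <= K by apply: sew_const_ge0.
  pose B := Num.max (C + K * (M + M0)) (K * M).
  exists B => s t; split=> [|Y' YY'].
    apply: (@le_trans _ _ ((C + K * (M + M0)) * `|val t - val s| `^ expo h)); last first.
      by rewrite ler_wpM2r ?powR_ge0 // le_max lexx.
    (* Comparison with [X0], where the residual is that of [z0] and is bounded by hypothesis. *)
    have -> : residual Y (W' Y) h s t = residual X0 z0 h s t
        + (residual Y (W' Y) h s t - residual X0 (W' X0) h s t).
      rewrite [residual X0 (W' X0) h s t](residual_ext X0 (w' := z0)) //; first by rewrite addrC subrK.
      by move=> k kF hk; apply: W'base => //; lia.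
    apply: le_trans (ler_normD _ _) _; rewrite mulrDl; apply: lerD; first exact: CP.
    rewrite residual'D // (_ : K * (M + M0) = K * M + K * M0); last by ring.
    apply: le_trans (ler_normB _ _) _; rewrite mulrDl.
    by apply: lerD; apply: sew_bound.
  rewrite residual'D //; have [M' [cM' _]] := coh h hF e Y'.
  apply: le_trans (sew_bound2 e0 e1 s t cM cM' (dM Y' YY')) _.
  rewrite ler_wpM2r ?powR_ge0 // mulrA ler_wpM2r // -/K.
  by rewrite le_max lexx orbT.
Qed.

Lemma controlled_lift X0 z0 :
  {in F, forall h, exists C, forall s t,
    `|residual X0 z0 h s t| <= C * `|val t - val s| `^ expo h} ->
  exists W : S -> I -> time T -> R,
    [/\ forall Y, {in F, forall h, W Y h (time0 T) = z0 h (time0 T)},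
        {in F, forall h, W X0 h =1 z0 h} &
        forall Y, {in F, forall h, exists C, residual_ctrl W Y h C}].
Proof.
move=> z0C.
have stN n : exists W, stage X0 z0 n W.
  elim: n => [|n [W]]; last exact: stageS.
  (* All degrees are below [N], so at stage 0 nothing has to be built. *)
  exists (fun _ _ _ => 0); split=> // [Y h|h|Y h] hF; have := dF hF; lia.
have [W st] := stN N; exists W; split=> [Y h hF|h hF|Y h hF].
- by apply: (stage_init st) => //; rewrite leq_addl.
- by apply: (stage_base st) => //; rewrite leq_addl.
- by apply: (stage_ctrl st) => //; rewrite leq_addl.
Qed.
End Lift.

(** * Translation by a character *)

Section ForestSize.
Variable A : finType.
Implicit Types (h k : forest A) (t : tree A).

Lemma fsizeE h (d : {fset tree A}) : fsubset (finsupp h) d ->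
  fsize h = (\sum_(t <- d) h t * Defs.tsize t)%N.
Proof.
move=> le; rewrite [LHS](big_fset_incl _ le) // => t td.
by rewrite -cmE_neq0 negbK => /eqP ->.
Qed.

Lemma fsizeM h k : fsize (mmul h k) = (fsize h + fsize k)%N.
Proof.
rewrite (fsizeE (fsubset_refl _)) mdomD.
rewrite (fsizeE (fsubsetUl _ (finsupp k))) (fsizeE (fsubsetUr (finsupp h) _)).
by rewrite -big_split /=; apply: eq_bigr => t _; rewrite cmM mulnDl.
Qed.

Lemma fsize1 : fsize (mone : forest A) = 0%N.
Proof. by rewrite /fsize mdom1 big_seq_fset0. Qed.

Lemma fsizeU t : fsize (ucm t) = Defs.tsize t.
Proof. by rewrite /fsize mdomU big_seq_fset1 cmUU mul1n. Qed.

Lemma fsize_eq0 h : fsize h = 0%N -> h = mone.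
Proof.
rewrite fsize_seq => h0; rewrite -[h]forest_seqK.
by case: (forest_seq h) h0 => [_|[a s] u] //; rewrite /forest_of big_nil.
Qed.

Lemma forest_seq_finsupp h u : u \in forest_seq h -> tree_of u \in finsupp h.
Proof.
move=> uh; rewrite -cmE_neq0 -forest_seq_count -lt0n -has_count.
by apply/hasP; exists (tree_of u) => //=; exact: map_f.
Qed.

End ForestSize.

Definition push_left (A : finType) (R : realType) (phi : halg A R -> R)
    (p : forest A * forest A) : halg A R :=
  mkmalgU p.2 (phi (fvec R p.1)).

(* [translate phi] is (phi (x) id) Delta, so that
   [star phi (mcoeff h) = mcoeff h \o translate phi].  When [phi] is a character
   it is an algebra endomorphism, so identities between such maps can be checked
   on trees; this replaces the coassociativity of [coprod]. *)
HB.lock Definition translate (A : finType) (R : realType) (phi : halg A R -> R)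
    (y : halg A R) : halg A R :=
  mmap (mkmalgU mone) (push_left phi) (coprod y).
Canonical translate_unlockable := Unlockable translate.unlock.

HB.lock Definition graft (A : finType) (R : realType) (a : A)
    (y : halg A R) : halg A R :=
  mmap (mkmalgU mone) (fun h => fvec R (ucm (node a h))) y.
Canonical graft_unlockable := Unlockable graft.unlock.

Section HopfTheory.
Variables (A : finType) (R : realType).
Implicit Types (h k : forest A) (t : tree A) (x : halg2 A R).

Lemma fvec_seq h :
  fvec R h = \prod_(u <- forest_seq h) fvec R (ucm (tree_of u)).
Proof.
rewrite -{1}[h]forest_seqK /forest_of.
elim: (forest_seq h) => [|u s IH]; first by rewrite !big_nil fvec1.
by rewrite !big_cons fvecM IH.
Qed.

(** Every forest is the product of its trees in the algebra. *)
Lemma halg_rmorph_ext (B : nzRingType) (f g : {rmorphism halg A R -> B}) h :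
  {in finsupp h, forall t, f (fvec R (ucm t)) = g (fvec R (ucm t))} ->
  f (fvec R h) = g (fvec R h).
Proof.
move=> fg; rewrite fvec_seq !rmorph_prod big_seq [RHS]big_seq.
by apply: eq_bigr => u uh; apply: fg; exact: forest_seq_finsupp.
Qed.

(** * Grading of the coproduct by the number of nodes *)

Definition graded n x := {in msupp x, forall p, (fsize p.1 + fsize p.2)%N = n}.

Lemma graded_fvec2 h k : graded (fsize h + fsize k) (fvec2 R h k).
Proof. by move=> p /(fsubsetP msuppU_le); rewrite inE => /eqP ->. Qed.

Lemma gradedD n x y : graded n x -> graded n y -> graded n (x + y).
Proof.
move=> gx gy p /(fsubsetP (msuppD_le _ _)); rewrite in_fsetU.
by case/orP; [exact: gx | exact: gy].
Qed.

Lemma gradedZ n c x : graded n x -> graded n (c *: x).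
Proof. by move=> gx p /(fsubsetP (msuppZ_le _ _)); exact: gx. Qed.

Lemma gradedM m n x y : graded m x -> graded n y -> graded (m + n) (x * y).
Proof.
move=> gx gy p /msuppM_le[p1 [p2 [/gx <- /gy <- ->]]] /=.
by rewrite !fsizeM addnACA.
Qed.

Lemma graded1 : graded 0 (1 : halg2 A R).
Proof.
by move=> p /(fsubsetP msuppU_le); rewrite inE => /eqP ->; rewrite /= fsize1.
Qed.

Lemma graded_graft_right n a x : graded n x -> graded n.+1 (graft_right a x).
Proof.
move=> gx; rewrite /graft_right big_seq.
apply: (big_ind (graded n.+1)) => [p|y z|p px]; first by rewrite msupp0 inE.
  exact: gradedD.
apply: gradedZ; rewrite -(gx p px) -addnS -(tsize_node a) -fsizeU.
exact: graded_fvec2.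
Qed.

Lemma coprod_seq h : coprod (fvec R h) =
  \prod_(u <- forest_seq h) coprod (fvec R (ucm (tree_of u))).
Proof. by rewrite {1}fvec_seq rmorph_prod. Qed.

(** Multiplicativity reduces forests to trees; for trees, induction applies because grafting adds
    one node to the right factor and the extra term carries the whole tree on the left. *)
Lemma coprod_graded h : graded (fsize h) (coprod (fvec R h)).
Proof.
have H k : {in finsupp k, forall t, graded (Defs.tsize t) (coprod (fvec R (ucm t)))} ->
    graded (fsize k) (coprod (fvec R k)).
  move=> Hk; rewrite coprod_seq fsize_seq.
  have := @forest_seq_finsupp _ k; have := canon_forest_seq k.
  elim: (forest_seq k) => [_ _|u s IH [cu cs] sub]; first by rewrite big_nil; exact: graded1.
  rewrite big_cons /=; apply: gradedM.
    by rewrite -{1}cu -/(Defs.tsize (tree_of u)); apply: Hk; apply: sub; exact: mem_head.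
  by apply: IH => // v vs; apply: sub; rewrite inE vs orbT.
suff Ht t : graded (Defs.tsize t) (coprod (fvec R (ucm t))) by apply: H.
elim/tree_node_ind: t => a k IH; rewrite coprod_node tsize_node.
apply: gradedD; first by apply: graded_graft_right; exact: H.
by rewrite -(tsize_node a) -fsizeU -[fsize _]addn0 -(fsize1 A); exact: graded_fvec2.
Qed.

Lemma translateE (phi : halg A R -> R) y :
  translate phi y = mmap (mkmalgU mone) (push_left phi) (coprod y).
Proof. by rewrite unlock. Qed.

Lemma graftE a (y : halg A R) :
  graft a y = mmap (mkmalgU mone) (fun h => fvec R (ucm (node a h))) y.
Proof. by rewrite unlock. Qed.

Lemma fvecE h : fvec R h = mkmalgU h 1.
Proof. by rewrite unlock. Qed.

Lemma scale_mkmalgU (c a : R) h :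
  c *: mkmalgU h a = mkmalgU h (c * a) :> halg A R.
Proof. by rewrite -mul_malgC malgM_def fgmulUU mul1m. Qed.

Lemma scale_fvec2 (c : R) h k : c *: fvec2 R h k = mkmalgU (h, k) c.
Proof. by rewrite -mul_malgC malgM_def fgmulUU mul1m mulr1. Qed.

Lemma mmap_mkmalgU (M N : conomType) (f : M -> malg N R) (k : M) (c : R) :
  mmap (mkmalgU mone) f (mkmalgU k c) = c *: f k.
Proof. by rewrite mmapU mul_malgC. Qed.

Lemma mmap_scaleE (M N : conomType) (f : M -> malg N R) (y : malg M R) :
  mmap (mkmalgU mone) f y = \sum_(k <- msupp y) mcoeff k y *: f k.
Proof. by apply: eq_bigr => k _; rewrite mul_malgC. Qed.

Lemma star_translate phi (psi : {linear halg A R -> R | *%R}) y :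
  star phi psi y = psi (translate phi y).
Proof.
rewrite /star /tensor translateE /mmap linear_sum /=; apply: eq_bigr => p _.
by rewrite mul_malgC linearZ /= /push_left mkmalgU_fvec linearZ.
Qed.

Lemma graft_additive a : additive (@graft A R a).
Proof. by move=> x y; rewrite !graftE; exact: raddfB. Qed.
HB.instance Definition _ a :=
  GRing.isAdditive.Build (halg A R) (halg A R) (@graft A R a) (graft_additive a).

Lemma graftU a (c : R) h :
  graft a (mkmalgU h c) = @mkmalgU (forest A) R (ucm (node a h)) c.
Proof. by rewrite graftE mmapU mul_malgC mkmalgU_fvec. Qed.

Lemma graft_scalable a : scalable (@graft A R a).
Proof.
move=> c y; rewrite [y]monalgE scaler_sumr !raddf_sum.
apply: eq_bigr => h _ /=.
by rewrite [in LHS]scale_mkmalgU [LHS]graftU [in RHS]graftU [RHS]scale_mkmalgU.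
Qed.
HB.instance Definition _ a := GRing.isScalable.Build R (halg A R) (halg A R) *:%R
  (@graft A R a) (graft_scalable a).

(** * Translation by a character as an algebra endomorphism *)

Section Character.
Variable phi : {lrmorphism halg A R -> R | *%R}.

Lemma push_left_mmorphism : mmorphism (push_left phi).
Proof.
split=> [p q|]; rewrite /push_left /=.
  by rewrite fvecM rmorphM malgM_def fgmulUU.
by rewrite fvec1 rmorph1.
Qed.
HB.instance Definition _ := isMultiplicative.Build
  (forest A * forest A)%type (halg A R) (push_left phi) push_left_mmorphism.

Lemma translate_additive : additive (translate phi).
Proof. by move=> x y; rewrite !translateE !raddfB. Qed.
HB.instance Definition _ := GRing.isAdditive.Build
  (halg A R) (halg A R) (translate phi) translate_additive.

Lemma translate_multiplicative : multiplicative (translate phi).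
Proof.
have [mM m1] : multiplicative
    (mmap (mkmalgU mone) (push_left phi) : halg2 A R -> halg A R).
  exact: mmap_is_multiplicative.
by split=> [x y|]; rewrite !translateE ?rmorphM ?rmorph1 ?mM ?m1.
Qed.
HB.instance Definition _ := GRing.isMultiplicative.Build
  (halg A R) (halg A R) (translate phi) translate_multiplicative.

Lemma mmap_graft_right a x :
  mmap (mkmalgU mone) (push_left phi) (graft_right a x) =
  graft a (mmap (mkmalgU mone) (push_left phi) x).
Proof.
rewrite /graft_right raddf_sum mmap_scaleE raddf_sum; apply: eq_bigr => p _ /=.
rewrite scale_fvec2 mmap_mkmalgU /push_left /=.
by rewrite [LHS]scale_mkmalgU [in RHS]scale_mkmalgU graftU.
Qed.

Lemma translate_node a h : translate phi (fvec R (ucm (node a h))) =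
  graft a (translate phi (fvec R h)) + mkmalgU mone (phi (fvec R (ucm (node a h)))).
Proof.
rewrite 2!translateE coprod_node raddfD /= mmap_graft_right; congr (_ + _).
by rewrite /fvec2 mmapU mul_malgC scale1r.
Qed.

Lemma translate_scalable : scalable (translate phi).
Proof. by move=> c y; rewrite !translateE linearZ /= mmapZ mul_malgC. Qed.
HB.instance Definition _ := GRing.isScalable.Build R (halg A R) (halg A R) *:%R
  (translate phi) translate_scalable.

Lemma translate_graft a y : translate phi (graft a y) =
  graft a (translate phi y) + mkmalgU mone (phi (graft a y)).
Proof.
rewrite [y]monalgE; apply: (big_ind (fun y => translate phi (graft a y) =
  graft a (translate phi y) + mkmalgU mone (phi (graft a y)))) => [|u v Hu Hv|h _].
- by rewrite !raddf0 addr0.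
- by rewrite !raddfD /= Hu Hv addrACA.
rewrite graftU; move: (mcoeff h y) => c.
have tZ k : translate phi (mkmalgU k c) = c *: translate phi (fvec R k).
  by rewrite mkmalgU_fvec linearZ.
have pZ k : phi (mkmalgU k c) = c * phi (fvec R k) by rewrite mkmalgU_fvec linearZ.
rewrite [LHS]tZ [in RHS]tZ translate_node scalerDr pZ [graft a (_ *: _)]linearZ.
by rewrite scale_mkmalgU.
Qed.

Lemma mcoeff_translate h k : mcoeff h (translate phi (fvec R k)) =
  \sum_(p <- msupp (coprod (fvec R k)) | p.2 == h)
    mcoeff p (coprod (fvec R k)) * phi (fvec R p.1).
Proof.
rewrite translateE mmap_scaleE raddf_sum /= [RHS]big_mkcond; apply: eq_bigr => p _.
by rewrite mcoeffZ /push_left mcoeffU; case: eqP; rewrite ?mulr1n ?mulr0n ?mulr0.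
Qed.

End Character.

(** Both sides are algebra morphisms, so trees suffice. There the cocycle identity gives equal
    grafted parts by induction, and the constant parts agree because [chi] is the convolution of
    [phi] and [psi]. *)
Lemma translate_comp (phi psi chi : {lrmorphism halg A R -> R | *%R}) :
  (forall y, star phi psi y = chi y) ->
  forall h, translate psi (translate phi (fvec R h)) = translate chi (fvec R h).
Proof.
move=> chiE h; apply: (halg_rmorph_ext (f := translate psi \o translate phi)
  (g := translate chi)) => t _ /=.
elim/tree_node_ind: t => a k IH.
have {}IH : translate psi (translate phi (fvec R k)) = translate chi (fvec R k).
  exact: (halg_rmorph_ext (f := translate psi \o translate phi)).
rewrite 2!translate_node raddfD /= translate_graft IH -addrA; congr (_ + _).
rewrite -chiE star_translate translate_node raddfD /= raddfD /=; congr (_ + _).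
by rewrite !mkmalgU_fvec !linearZ /= fvec1 !rmorph1 mulr1.
Qed.

(** * The counit and the triangularity of translation *)

Definition counit (y : halg A R) : R := mcoeff mone y.

HB.instance Definition _ := GRing.isAdditive.Build (halg A R) R counit
  (mcoeffB mone).
HB.instance Definition _ := GRing.isMultiplicative.Build (halg A R) R counit
  (@mcoeff1g_is_multiplicative (forest A) R).
HB.instance Definition _ := GRing.isScalable.Build R (halg A R) R *%R counit
  (fun c y => mcoeffZ c y mone).

Lemma counit_fvec h : counit (fvec R h) = (h == mone)%:R.
Proof. by rewrite unlock [LHS]mcoeffU1. Qed.

Lemma translate_counit h : translate counit (fvec R h) = fvec R h.
Proof.
apply: (halg_rmorph_ext (f := translate counit) (g := idfun)) => t _ /=.
elim/tree_node_ind: t => a k IH.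
have {}IH : translate counit (fvec R k) = fvec R k.
  exact: (halg_rmorph_ext (f := translate counit) (g := idfun)).
rewrite translate_node IH /= counit_fvec.
have -> : (ucm (node a k) == mone) = false by exact: cm1_eq1.
by rewrite monalgU0 addr0 [in LHS]fvecE graftU -fvecE.
Qed.

(** If the right factor is at least as large as [k], the grading forces the left factor to be the
    empty forest, on which all characters agree. So [phi] may be replaced by the counit, whose
    translation is the identity. *)
Lemma translate_low (phi : {lrmorphism halg A R -> R | *%R}) h k :
  (fsize k <= fsize h)%N -> mcoeff h (translate phi (fvec R k)) = (h == k)%:R.
Proof.
move=> kh; transitivity (mcoeff h (translate counit (fvec R k))).
  rewrite !mcoeff_translate big_seq_cond [RHS]big_seq_cond.
  apply: eq_bigr => p /andP[/(coprod_graded (h := k)) pk /eqP ph].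
  have -> : p.1 = mone.
    apply: fsize_eq0; apply/eqP; rewrite -leqn0 -(leq_add2r (fsize h)).
    by rewrite add0n -{1}ph pk.
  by rewrite fvec1 !rmorph1.
by rewrite translate_counit fvecE mcoeffU1 eq_sym.
Qed.

Lemma msupp_translate (phi : {lrmorphism halg A R -> R | *%R}) h k :
  h \in msupp (translate phi (fvec R k)) -> (fsize h <= fsize k)%N.
Proof.
rewrite -mcoeff_neq0; apply: contraNT; rewrite -ltnNge => kh.
rewrite translate_low ?(ltnW kh) //; case: (eqVneq h k) => [hk|_]; last by rewrite eqxx.
by rewrite hk ltnn in kh.
Qed.

End HopfTheory.

(** * Kernels of rough paths *)

Section RoughPathKernel.
Variables (A : finType) (R : realType) (T : {posnum R}) (alpha : R).
Hypothesis alpha0 : 0 < alpha.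
Implicit Types (X Y : rough_path A T alpha) (h k : forest A) (s t u : time T).

Lemma rp_one X s t : X s t (fvec R mone) = 1.
Proof. by rewrite fvec1 rmorph1. Qed.

Lemma time_near s (e : R) : 0 < e -> exists2 t, s != t & `|val t - val s| <= e.
Proof.
move=> e0; have T0 : 0 < T%:num by [].
case: s => s sP; have /andP[s0 sT] := sP.
pose r : R := Num.min e (T%:num / 2).
have r0 : 0 < r by rewrite lt_min e0 divr_gt0.
have re : r <= e by rewrite ge_min lexx.
have rT : r <= T%:num / 2 by rewrite ge_min lexx orbT.
(* A step of length at most [T / 2] towards the farther end stays in the interval. *)
have [h|h] := leP s (T%:num / 2).
  have tT : 0 <= s + r <= T%:num by apply/andP; split; lra.
  exists (exist _ (s + r) tT).
    by rewrite -(inj_eq val_inj) /= lt_eqF // ltrDl.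
  by rewrite /= addrAC subrr add0r gtr0_norm.
have tT : 0 <= s - r <= T%:num by apply/andP; split; lra.
exists (exist _ (s - r) tT).
  by rewrite -(inj_eq val_inj) /= gt_eqF // ltrBlDr ltrDl.
by rewrite /= addrAC subrr add0r normrN gtr0_norm.
Qed.

Lemma powR_small s (x K b : R) : 0 <= K -> 0 < b ->
  (forall t, s != t -> x <= K * `|val t - val s| `^ b) -> x <= 0.
Proof.
move=> K0 b0 H; rewrite leNgt; apply/negP => x0.
have K1 : 0 < K + 1 by rewrite ltr_wpDl.
have y0 : 0 < x / (K + 1) by rewrite divr_gt0.
(* The distance is chosen so that its power [b] is at most [x / (K + 1)], which makes the assumed
   bound smaller than [x]. *)
have [t st le] := time_near s (powR_gt0 b^-1 y0).
have := H _ st; apply/negP; rewrite -ltNge.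
apply: (@le_lt_trans _ _ (K * (x / (K + 1)))).
  rewrite ler_wpM2l // -[leRHS](@powRr1 R) ?(ltW y0) //.
  rewrite -[X in _ <= _ `^ X](@mulVf R b) ?gt_eqF // powRrM.
  by rewrite ge0_ler_powR ?(ltW b0) // nnegrE ?powR_ge0.
by rewrite mulrA ltr_pdivrMr // mulrC ltr_pM2l // ltrDl.
Qed.

Lemma rp_offdiag X h : exists2 C : R, 0 <= C & forall s t, s != t ->
  `|X s t (fvec R h)| <= C * `|val t - val s| `^ (alpha * (fsize h)%:R).
Proof.
exists (fine (hoelder (alpha * (fsize h)%:R) (fun s t => X s t (fvec R h)))).
  by apply: fine_ge0; exact: hoelder_ge0.
by move=> s t; apply: hoelder_le_fine; exact: rp_hoelder.
Qed.

(** The Hoelder seminorms ignore the diagonal. The Chen relation through a nearby [t] writes the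
    value as a sum of products over [(s, t)] and [(t, s)], each of order [alpha * |h|] by the
    grading; letting [t] tend to [s] gives zero. *)
Lemma rp_diag X s h : h != mone -> X s s (fvec R h) = 0.
Proof.
move=> h1; apply/eqP; rewrite -normr_le0.
have h0 : (0 < fsize h)%N.
  by rewrite lt0n; apply: contra_neq h1; exact: fsize_eq0.
pose D := coprod (fvec R h).
have [C C0 CP] : exists2 C : R, 0 <= C &
    {in msupp D, forall p, forall t, s != t ->
      `|mcoeff p D * (X s t (fvec R p.1) * X t s (fvec R p.2))|
        <= C * `|val t - val s| `^ (alpha * (fsize h)%:R)}.
  apply: seq_bound => [p x y xy Px t st|p pD].
    by apply: le_trans (Px t st) _; rewrite ler_wpM2r ?powR_ge0.
  have [C1 C10 H1] := rp_offdiag X p.1; have [C2 C20 H2] := rp_offdiag X p.2.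
  exists (`|mcoeff p D| * (C1 * C2)) => t st.
  rewrite !normrM -mulrA ler_wpM2l //.
  have -> : alpha * (fsize h)%:R = alpha * (fsize p.1)%:R + alpha * (fsize p.2)%:R.
    by rewrite -mulrDr -natrD (coprod_graded pD).
  rewrite powRD; last first.
    by rewrite normr_eq0 subr_eq0 (inj_eq val_inj) [t == s]eq_sym st implybT.
  rewrite mulrACA; apply: ler_pM => //; first exact: H1.
  by rewrite distrC; apply: H2; rewrite eq_sym.
apply: (@powR_small s _ ((size (msupp D))%:R * C) (alpha * (fsize h)%:R)).
- by rewrite mulr_ge0.
- by rewrite mulr_gt0 ?ltr0n.
move=> t st; rewrite -(rp_chen X s t s) /star /tensor -/D -mulrA.
apply: ler_norm_sum_seq => [|p pD _]; first by rewrite mulr_ge0 ?powR_ge0.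
exact: CP.
Qed.

Lemma rp_bound X h : exists2 C : R, 0 <= C & forall s t,
  `|X s t (fvec R h)| <= C * `|val t - val s| `^ (alpha * (fsize h)%:R).
Proof.
have [->|h1] := eqVneq h mone.
  exists 1 => // s t.
  by rewrite rp_one normr1 fsize1 mulr0 powRr0 mulr1.
have [C C0 CP] := rp_offdiag X h; exists C => // s t.
have [<-|st] := eqVneq s t; last exact: CP.
by rewrite rp_diag // normr0 mulr_ge0 ?powR_ge0.
Qed.

Lemma rp_dist_bound X Y h s t : (fsize h <= rp_level alpha)%N ->
  `|X s t (fvec R h) - Y s t (fvec R h)|
    <= rp_dist X Y * `|val t - val s| `^ (alpha * (fsize h)%:R).
Proof.
move=> hN; have d0 := rp_dist_ge0 X Y.
have [->|h1] := eqVneq h mone.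
  by rewrite !rp_one subrr normr0 mulr_ge0 ?powR_ge0.
have [<-|st] := eqVneq s t.
  by rewrite !rp_diag // subrr normr0 mulr_ge0 ?powR_ge0.
have /rp_distP H := lexx (rp_dist X Y); apply: H => //.
by split=> //= /eqP; apply/negP.
Qed.

(* The matrix of the translation by X_{s,t} in the basis of forests. *)
Definition kernel X h k s t : R := star (X s t) (mcoeff h) (fvec R k).

Lemma kernel_low X s t h k : (fsize k <= fsize h)%N -> kernel X h k s t = (h == k)%:R.
Proof. by move=> kh; rewrite /kernel star_translate /= translate_low. Qed.

(** Translations compose as the rough path does; since they do not increase the size, only forests
    no larger than [k] occur in between. *)
Lemma kernel_chen X s u t h k (d : {fset forest A}) :
  (forall j, (fsize j <= fsize k)%N -> j \in d) ->
  kernel X h k s t = \sum_(j <- d) kernel X j k s u * kernel X h j u t.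
Proof.
move=> dP; rewrite /kernel star_translate /=.
rewrite -(translate_comp (phi := X s u) (psi := X u t)); last exact: rp_chen.
rewrite -(star_translate _ (mcoeff h)) (star_sum _ _ (d := d)).
  by apply: eq_bigr => j _; rewrite [in RHS]star_translate.
by apply/fsubsetP => j /msupp_translate/dP.
Qed.

Lemma kernelE X h k s t : kernel X h k s t =
  \sum_(p <- msupp (coprod (fvec R k)) | p.2 == h)
    mcoeff p (coprod (fvec R k)) * X s t (fvec R p.1).
Proof. by rewrite /kernel star_translate /= mcoeff_translate. Qed.

Lemma coprod_left_size h k p : p \in msupp (coprod (fvec R k)) -> p.2 = h ->
  fsize p.1 = (fsize k - fsize h)%N.
Proof. by move=> /(coprod_graded (h := k)) <- <-; rewrite addnK. Qed.

Lemma kernel_bound X h k : exists C : R, forall s t,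
  `|kernel X h k s t| <= C * `|val t - val s| `^ ((fsize k - fsize h)%:R * alpha).
Proof.
pose D := coprod (fvec R k).
have [C C0 CP] : exists2 C : R, 0 <= C & {in msupp D, forall p, p.2 = h -> forall s t,
   `|mcoeff p D * X s t (fvec R p.1)|
     <= C * `|val t - val s| `^ ((fsize k - fsize h)%:R * alpha)}.
  apply: seq_bound => [p x y xy Px ph s t|p pD].
    by apply: le_trans (Px ph s t) _; rewrite ler_wpM2r ?powR_ge0.
  have [C C0 CP] := rp_bound X p.1; exists (`|mcoeff p D| * C) => ph s t.
  by rewrite normrM -mulrA ler_wpM2l // -(coprod_left_size pD ph) [_%:R * alpha]mulrC.
exists ((size (msupp D))%:R * C) => s t; rewrite kernelE -mulrA.
apply: ler_norm_sum_seq => [|p pD /eqP ph]; first by rewrite mulr_ge0 ?powR_ge0.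
exact: CP.
Qed.

Lemma kernel_diag X h k s : kernel X h k s s = (h == k)%:R.
Proof.
have [kh|hk] := leqP (fsize k) (fsize h); first exact: kernel_low.
have [C /(_ s s)] := kernel_bound X h k.
rewrite subrr normr0 powR0 ?mulr0 ?normr_le0; last first.
  by rewrite mulf_neq0 ?gt_eqF // ltr0n subn_gt0.
by case: (eqVneq h k) hk => [->|_ _ /eqP]; rewrite ?ltnn.
Qed.

Lemma kernel_dist h k : (fsize k <= rp_level alpha)%N ->
  exists C : R, forall X Y s t, `|kernel X h k s t - kernel Y h k s t|
    <= C * rp_dist X Y * `|val t - val s| `^ ((fsize k - fsize h)%:R * alpha).
Proof.
move=> kN; pose D := coprod (fvec R k).
have [C C0 CP] : exists2 C : R, 0 <= C & {in msupp D, forall p, `|mcoeff p D| <= C}.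
  apply: seq_bound => [p x y xy Px|p pD]; first exact: le_trans xy.
  by exists `|mcoeff p D|.
exists ((size (msupp D))%:R * C) => X Y s t; rewrite !kernelE -sumrB -!mulrA.
have d0 := rp_dist_ge0 X Y.
apply: ler_norm_sum_seq => [|p pD /eqP ph]; first by rewrite !mulr_ge0 ?powR_ge0.
rewrite -mulrBr normrM; apply: ler_pM => //; first exact: CP.
rewrite -(coprod_left_size pD ph) [_ * alpha]mulrC; apply: rp_dist_bound.
(* Left factors have at most as many nodes as [k], hence are among the forests seen by the
   metric. *)
by apply: leq_trans kN; rewrite -(coprod_graded pD) leq_addr.
Qed.

End RoughPathKernel.

(** * The continuous field *)

Section ControlledField.
Variables (A : finType) (R : realType) (T : {posnum R}) (alpha : R).
Hypothesis alpha0 : 0 < alpha.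
Implicit Types (X Y : rough_path A T alpha) (e : R).
Local Notation N := (rp_level alpha).
Local Notation F := (@forests_le A N.-1).

(** * Comparing controlled paths over different rough paths *)

(** The two paths lie in different Banach spaces; they are compared through initial values and
    through remainders, each taken along its own rough path. *)
Definition ctrl_close X Y e (z : ctrl_path X) (w : ctrl_path Y) : Prop :=
  forall h, F h ->
    `|mcoeff h (z (time0 T)) - mcoeff h (w (time0 T))| <= e /\
    forall s t, s != t -> `|remainder X z h s t - remainder Y w h s t|
      <= e * `|val t - val s| `^ ((N - fsize h)%:R * alpha).

Lemma ctrl_closeW X Y e e' (z : ctrl_path X) (w : ctrl_path Y) :
  e <= e' -> ctrl_close e z w -> ctrl_close e' z w.
Proof.
move=> le H h hF; have [H1 H2] := H h hF; split; first exact: le_trans le.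
move=> s t st; apply: le_trans (H2 s t st) _.
by rewrite ler_wpM2r ?powR_ge0.
Qed.

Lemma ctrl_close_sym X Y e (z : ctrl_path X) (w : ctrl_path Y) :
  ctrl_close e z w -> ctrl_close e w z.
Proof.
move=> H h hF; have [H1 H2] := H h hF; split; first by rewrite distrC.
by move=> s t st; rewrite distrC; exact: H2.
Qed.

Lemma ctrl_close_trans X Y V e e' (z : ctrl_path X) (w : ctrl_path Y)
    (v : ctrl_path V) :
  ctrl_close e z w -> ctrl_close e' w v -> ctrl_close (e + e') z v.
Proof.
move=> zw wv h hF; have [H1 H2] := zw h hF; have [H3 H4] := wv h hF; split.
  by apply: le_trans (ler_distD (mcoeff h (w (time0 T))) _ _) _; exact: lerD.
move=> s t st; apply: le_trans (ler_distD (remainder Y w h s t) _ _) _.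
by rewrite mulrDl lerD ?H2 ?H4.
Qed.

Lemma ctrl_fun_linear X (c : R) (z w : ctrl_path X) :
  ctrl_fun (c *: z + w) = c *: ctrl_fun z + ctrl_fun w.
Proof. by []. Qed.

Lemma mcoeff_ctrl_linear X (c : R) (z w : ctrl_path X) h t :
  mcoeff h ((c *: z + w) t) = c * mcoeff h (z t) + mcoeff h (w t).
Proof.
rewrite ctrl_fun_linear -mcoeffZ -mcoeffD; exact: erefl.
Qed.

Lemma ctrl_close_linear X Y e e' (c : R) (z z' : ctrl_path X) (w w' : ctrl_path Y) :
  ctrl_close e z w -> ctrl_close e' z' w' ->
  ctrl_close (`|c| * e + e') (c *: z + z') (c *: w + w').
Proof.
move=> zw zw' h hF; have [H1 H2] := zw h hF; have [H3 H4] := zw' h hF.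
have lin (a b a' b' : R) : c * a + a' - (c * b + b') = c * (a - b) + (a' - b').
  by ring.
split=> [|s t st].
  rewrite !mcoeff_ctrl_linear lin; apply: le_trans (ler_normD _ _) _.
  by rewrite normrM lerD // ler_wpM2l.
rewrite !ctrl_fun_linear !remainderP lin; apply: le_trans (ler_normD _ _) _.
by rewrite normrM mulrDl lerD ?H4 // -mulrA ler_wpM2l ?H2.
Qed.

Lemma ctrl_close_norm X e (z w : ctrl_path X) : `|z - w| <= e -> ctrl_close e z w.
Proof.
move=> zw h hF.
have -> : mcoeff h (z (time0 T)) - mcoeff h (w (time0 T)) =
    mcoeff h ((z - w) (time0 T)) by rewrite /= mcoeffB.
split; first exact: le_trans (ctrl_bound0 _ hF) zw.
move=> s t st.
have -> : remainder X z h s t - remainder X w h s t = remainder X (z - w) h s t.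
  have -> : ctrl_fun (z - w) = (- 1) *: ctrl_fun w + ctrl_fun z.
    by rewrite scaleN1r addrC.
  by rewrite remainderP mulN1r addrC.
apply: le_trans (ctrl_boundR _ hF st) _.
by rewrite ler_wpM2r ?powR_ge0.
Qed.

Lemma ctrl_close_nrm_le X Y e (z : ctrl_path X) (w : ctrl_path Y) :
  ctrl_close e z w -> `|z| <= `|w| + (e + e) *+ size (fset_set F).
Proof.
move=> zw; rewrite !ctrl_normE -lee_fin EFinD !ctrl_nrmE.
have -> : (e + e) *+ size (fset_set F) = \sum_(h <- fset_set F) (e + e).
  by rewrite big_const_seq count_predT iter_addr addr0.
rewrite -sumEFin /ctrl_norm -big_split /= big_seq [leRHS]big_seq.
apply: lee_sum => h.
rewrite in_fset_set; last exact: finite_forests_le.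
rewrite inE => /zw[H1 H2].
rewrite /ctrl_term EFinD addeACA; apply: leeD.
  rewrite -EFinD lee_fin -lerBlDl.
  by apply: le_trans H1; exact: lerB_dist.
apply: (le_trans (hoelderD_le _ (F := remainder Y w h)
  (G := fun s t => remainder X z h s t - remainder Y w h s t) _)).
  by move=> s t; rewrite addrC subrK.
by rewrite leeD2l //; apply/hoelder_leP.
Qed.

Lemma ctrl_close_nrm X Y e (z : ctrl_path X) (w : ctrl_path Y) :
  ctrl_close e z w -> `| `|z| - `|w| | <= (e + e) *+ size (fset_set F).
Proof.
move=> zw; have h1 := ctrl_close_nrm_le zw.
have h2 := ctrl_close_nrm_le (ctrl_close_sym zw).
by rewrite ler_norml; move: h1 h2; lra.
Qed.

(** * The space of sections and its closure properties *)

Definition ctrl_sections : set (forall X, ctrl_path X) :=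
  [set gam | forall X e, 0 < e -> \forall Y \near X, ctrl_close e (gam X) (gam Y)].


Lemma nbhs_rp X (P : rough_path A T alpha -> Prop) (d : R) : 0 < d ->
  (forall Y, rp_dist X Y < d -> P Y) -> \forall Y \near X, P Y.
Proof. by move=> d0 H; apply/nbhs_ballP; exists d. Qed.

Lemma ctrl_sections0 : ctrl_sections (fun X => 0).
Proof.
move=> X e e0; near=> Y => h hF; rewrite mcoeff0 subrr normr0; split; first exact: ltW.
move=> s t _; rewrite /remainder /= mcoeff0 !linear0 subrr normr0.
by rewrite mulr_ge0 ?powR_ge0 ?(ltW e0).
Unshelve. all: by end_near. Qed.

Lemma ctrl_sections_linear (c : R) gam del : ctrl_sections gam -> ctrl_sections del ->
  ctrl_sections (fun X => c *: gam X + del X).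
Proof.
move=> Hg Hd X e e0.
have c0 : 0 < `|c| + 1 by rewrite ltr_wpDl.
have e1 : 0 < e / 2 / (`|c| + 1) by rewrite !divr_gt0.
have e2 : 0 < e / 2 by rewrite divr_gt0.
apply: filterS2 (Hg X _ e1) (Hd X _ e2) => Y gY dY.
apply: ctrl_closeW (ctrl_close_linear c gY dY).
rewrite [leRHS](splitr e) lerD2r mulrA ler_pdivrMr // mulrC ler_wpM2l ?(ltW e2) //.
by rewrite lerDl.
Qed.

Lemma ctrl_sections_continuous gam : ctrl_sections gam ->
  continuous (fun X => `|gam X|).
Proof.
move=> Hg X; apply/(cvgrPdist_le (FF := nbhs_filter X)) => e e0.
set n := size (fset_set F).
(* The norms differ by at most [2 * n] times the closeness; [n.+1] keeps the denominator
   positive. *)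
have d0 : 0 < e / (2 * n.+1%:R) by rewrite divr_gt0 // mulr_gt0.
have close_gam : \forall Y \near X, ctrl_close (e / (2 * n.+1%:R)) (gam X) (gam Y).
  exact: Hg.
near=> Y; have /ctrl_close_nrm/le_trans : ctrl_close (e / (2 * n.+1%:R)) (gam X) (gam Y).
  by near: Y.
apply; rewrite -/n.
rewrite -mulr2n -mulrnA -[X in X *+ _]mulr1 -mulrnAr -mulrA ger_pMr //.
by rewrite mulrC ler_pdivrMr ?mulr_gt0 // mul1r natrM ler_pM2l // ler_nat.
Unshelve. all: by end_near. Qed.

Lemma ctrl_sections_local (del : forall X, ctrl_path X) :
  (forall X e, 0 < e -> exists2 gam, ctrl_sections gam &
     \forall Y \near X, `|del Y - gam Y| <= e) -> ctrl_sections del.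
Proof.
move=> H X e e0; have e3 : 0 < e / 3 by rewrite divr_gt0.
have [gam Hg near_gam] := H X _ e3.
have close_X := ctrl_close_norm (nbhs_singleton near_gam).
apply: filterS2 near_gam (Hg X _ e3) => Y /ctrl_close_norm/ctrl_close_sym gY XY.
apply: ctrl_closeW (ctrl_close_trans (ctrl_close_trans close_X XY) gY).
lra.
Qed.

(** * A section through a given controlled path *)

Let Fs := fset_set F.

Let mem_Fs h : (h \in Fs) = `[< F h >].
Proof.
rewrite in_fset_set; last exact: finite_forests_le.
by apply/idP/asboolP; rewrite inE.
Qed.

Lemma remainder_residual X (Z : time T -> halg A R) (w : forest A -> time T -> R) h s t :
  (forall u, fsubset (msupp (Z u)) Fs) ->
  {in Fs, forall k u, mcoeff k (Z u) = w k u} -> h \in Fs ->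
  remainder X Z h s t = residual Fs (@kernel A R T alpha) X w h s t.
Proof.
move=> supp Zw hF; rewrite /remainder (star_sum _ _ (supp s)) /residual Zw //.
congr (_ - _); rewrite big_seq [RHS]big_seq; apply: eq_bigr => k kF.
by rewrite Zw.
Qed.

Definition path_of (w : forest A -> time T -> R) (t : time T) : halg A R :=
  \sum_(h <- Fs) mkmalgU h (w h t).

Lemma mcoeff_path_of w k t : mcoeff k (path_of w t) = if k \in Fs then w k t else 0.
Proof.
rewrite /path_of raddf_sum /= (eq_bigr (fun h => if h == k then w h t else 0)).
  case: ifPn => kF.
    rewrite (bigD1_seq k) ?fset_uniq //= eqxx big1 ?addr0 // => h /negPf ->.
    by [].
  rewrite big_seq big1 // => h hF; case: eqP => // hk.
  by rewrite -hk hF in kF.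
by move=> h _; rewrite mcoeffU; case: eqP.
Qed.

Lemma msupp_path_of w t : fsubset (msupp (path_of w t)) Fs.
Proof.
apply/fsubsetP => k; rewrite -mcoeff_neq0 mcoeff_path_of.
by case: ifP => //; rewrite eqxx.
Qed.

Hypothesis alpha1 : alpha < 1.
Hypothesis alphaN : N%:R * alpha < 1.

(** [controlled_lift] is applied with the rough paths as parameters and the translation matrices as
    kernels. Its residuals are the remainders, so their bounds make each value a controlled path and
    their local Lipschitz estimates make the family a section. *)
Lemma ctrl_section_through X0 (z0 : ctrl_path X0) :
  exists2 gam, ctrl_sections gam & gam X0 = z0.
Proof.
have N0 : (0 < N)%N.
  rewrite /rp_level truncn_gt0 invf_ge1 // ltW //.
(* Truncation at [N.-1] gives strict inequality because [N] is positive, so every remainder exponent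
   is positive. *)
have FN h : h \in Fs -> (fsize h < N)%N.
  by rewrite mem_Fs => /asboolP; rewrite /forests_le /= => hN; rewrite -(prednK N0) ltnS.
pose w0 h t := mcoeff h (z0 t).
have [W [W0 WX0 WC]] : exists W : rough_path A T alpha -> forest A -> time T -> R,
    [/\ forall Y, {in Fs, forall h, W Y h (time0 T) = w0 h (time0 T)},
        {in Fs, forall h, W X0 h =1 w0 h} &
        forall Y, {in Fs, forall h, exists C,
          residual_ctrl Fs (@fsize A) N alpha (@kernel A R T alpha) (@rp_dist A R T alpha) W Y h C}].
  apply: (@controlled_lift R T _ _ Fs (@fsize A) N alpha) => //.
  - by move=> Y s t h k _ _; exact: kernel_low.
  - move=> Y s u t h k hF kF; apply: kernel_chen => j jk.
    rewrite mem_Fs; apply/asboolP; rewrite /forests_le /=.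
    by rewrite -ltnS (prednK N0); exact: leq_ltn_trans (FN k kF).
  - move=> Y; have [C C0 CP] : exists2 C : R, 0 <= C & {in Fs &, forall h k, forall s t,
      `|kernel Y h k s t| <= C * `|val t - val s| `^ ((fsize k - fsize h)%:R * alpha)}.
      apply: seq_bound2 => [h k x y xy P s t|h k _ _]; last exact: kernel_bound.
      by apply: le_trans (P s t) _; rewrite ler_wpM2r ?powR_ge0.
    by exists C => // h k hF kF _; exact: CP.
  - exact: rp_dist_ge0.
  - have [C C0 CP] : exists2 C : R, 0 <= C & {in Fs &, forall h k, forall X Y s t,
      `|kernel X h k s t - kernel Y h k s t|
      <= C * rp_dist X Y * `|val t - val s| `^ ((fsize k - fsize h)%:R * alpha)}.
      apply: seq_bound2 => [h k x y xy P X Y s t|h k _ kF].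
        apply: le_trans (P X Y s t) _; rewrite ler_wpM2r ?powR_ge0 //.
        by rewrite ler_wpM2r // rp_dist_ge0.
      by apply: kernel_dist => //; exact/ltnW/FN.
    by exists C => // X Y h k hF kF _; exact: CP.
  - move=> h hF; exists (ctrl_nrm z0) => s t.
    rewrite -(@remainder_residual X0 z0 w0) //; last exact: ctrl_supp.
    have hF' : F h by move: hF; rewrite mem_Fs => /asboolP.
    (* The norm controls only distinct times; on the diagonal the kernel is the identity and the
       residual vanishes. *)
    have [<-|st] := eqVneq s t; last exact: ctrl_boundR.
    rewrite subrr normr0 powR0; last first.
      by rewrite mulf_neq0 ?gt_eqF // ltr0n subn_gt0 FN.
    rewrite mulr0 normr_le0 (@remainder_residual X0 z0 w0) //;
      last exact: ctrl_supp.
    rewrite /residual (bigD1_seq h) ?fset_uniq //= kernel_diag // eqxx mulr1.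
    rewrite big1 ?addr0 ?subrr // => k kh.
    by rewrite kernel_diag // eq_sym (negbTE kh) mulr0.
pose Z Y := path_of (W Y).
have ZE Y : {in Fs, forall k u, mcoeff k (Z Y u) = W Y k u}.
  by move=> k kF u; rewrite mcoeff_path_of kF.
have suppZ Y u : fsubset (msupp (Z Y u)) Fs by exact: msupp_path_of.
have Zctrl Y : Z Y \in controlled Y.
  apply/controlledP; split=> [t h /(fsubsetP (suppZ Y t))|].
    by rewrite mem_Fs => /asboolP.
  have [C C0 CP] : exists2 C : R, 0 <= C & {in Fs, forall h,
      residual_ctrl Fs (@fsize A) N alpha (@kernel A R T alpha)
        (@rp_dist A R T alpha) W Y h C /\ `|W Y h (time0 T)| <= C}.
    apply: seq_bound => [h x y xy [H1 H2]|h hF].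
      split; last exact: le_trans xy.
      by apply: residual_ctrl_mono H1 => // *; exact: rp_dist_ge0.
    have [C CP] := WC Y h hF; exists (Num.max C `|W Y h (time0 T)|); split.
      apply: residual_ctrl_mono CP; last by rewrite le_max lexx.
      by move=> *; exact: rp_dist_ge0.
    by rewrite le_max lexx orbT.
  apply: (@le_lt_trans _ _ ((C + C) *+ size Fs)%:E); last exact: ltry.
  apply: ctrl_norm_le => // h Fh.
    have hF : h \in Fs by rewrite mem_Fs; exact/asboolP.
    by rewrite ZE //; have [] := CP h hF.
  move=> s t st; have hF : h \in Fs by rewrite mem_Fs; exact/asboolP.
  rewrite (remainder_residual _ _ _ (suppZ Y) (ZE Y) hF).
  by have [H _] := CP h hF; have [] := H s t.
exists (fun Y => CtrlPath (Zctrl Y)); last first.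
  apply: val_inj; apply/funext => t; apply/malgP => h /=.
  rewrite mcoeff_path_of; case: ifPn => hF; first exact: WX0.
  rewrite mcoeff_outdom //; apply: contraNN hF.
  exact: (fsubsetP (ctrl_supp z0 t)).
move=> X e e0.
have [C C0 CP] : exists2 C : R, 0 <= C & {in Fs, forall h,
    residual_ctrl Fs (@fsize A) N alpha (@kernel A R T alpha)
      (@rp_dist A R T alpha) W X h C}.
  apply: seq_bound => [h x y xy|h hF]; last exact: WC.
  by apply: residual_ctrl_mono => // *; exact: rp_dist_ge0.
have C1 : 0 < C + 1 by rewrite ltr_wpDl.
(* Radius 1 gives access to the Lipschitz estimate, and [e / (C + 1)] makes its right-hand side at
   most [e]. *)
apply: (@nbhs_rp X _ (Num.min 1 (e / (C + 1)))).
  by rewrite lt_min ltr01 divr_gt0.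
move=> Y; rewrite lt_min => /andP[XY1 XYe] h Fh.
have hF : h \in Fs by rewrite mem_Fs; exact/asboolP.
split=> [|s t st] /=.
  have e0E V : mcoeff h (Z V (time0 T)) = w0 h (time0 T).
    by rewrite (ZE V h hF) (W0 V h hF).
  by rewrite [X in `|X - _|]e0E [X in `|_ - X|]e0E subrr normr0 ltW.
rewrite [X in `|X - _|](remainder_residual X s t (suppZ X) (ZE X) hF).
rewrite [X in `|_ - X|](remainder_residual Y s t (suppZ Y) (ZE Y) hF).
have [_ H] := CP h hF s t; apply: le_trans (H Y (ltW XY1)) _.
rewrite ler_wpM2r ?powR_ge0 //.
apply: (@le_trans _ _ ((C + 1) * rp_dist X Y)).
  by rewrite ler_wpM2r ?rp_dist_ge0 // lerDl.
by rewrite mulrC -ler_pdivlMr // ltW.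
Qed.

End ControlledField.

Theorem theorem1p1 (R : realType) (A : finType) (T : {posnum R}) (alpha : R)
    (A_gt0 : (0 < #|A|)%N) (alpha01 : 0 < alpha < 1)
    (alphaN : forall n : nat, (0 < n)%N -> alpha <> n%:R^-1) :
  exists Gamma : set (forall X : rough_path A T alpha, ctrl_path X),
    @continuous_field R (rough_path A T alpha)
      (fun X => ctrl_path X : completeNormedModType R) Gamma.
Proof.
have /andP[alpha0 alpha1] := alpha01.
(* The integer part satisfies [N <= 1 / alpha], and equality would make [alpha] the inverse of a
   positive integer. *)
have Nalpha : (rp_level alpha)%:R * alpha < 1.
  have ia0 : 0 <= alpha^-1 by rewrite invr_ge0 ltW.
  have /andP[le _] := truncn_itv ia0.
  rewrite -ltr_pdivlMr // div1r lt_neqAle le andbT.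
  apply/eqP => e; apply: (alphaN (rp_level alpha)).
    by rewrite -(ltr_nat R) e invr_gt0.
  by rewrite e invrK.
exists (@ctrl_sections A R T alpha); split.
- exact: ctrl_sections0.
- exact: ctrl_sections_linear.
(* Any point [z] of the open set is itself the value at [X] of a section. *)
- move=> X O [z Oz] _; have [gam Hg gX] := ctrl_section_through alpha0 alpha1 Nalpha z.
  by exists z; split=> //; exists gam.
- exact: ctrl_sections_continuous.
- exact: ctrl_sections_local.
Qed.
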